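(* Let $P\in\mathbb{Q}^{d\times d}$ be a stochastic matrix, $\iota\in\mathbb{Q}^d$ an initial distribution, and $w\colon\mathbb{R}^d\to\mathbb{R}$ a continuous weight function. Then one can compute, in exponential time (in the bit length of $(P,\iota)$), points $\pi_0,\ldots,\pi_{l-1}\in\mathbb{Q}^d$ for some $l\le d^d$ such that $$\mathcal{MP}_w(P,\iota)=\frac1l\sum_{i=0}^{l-1}w(\pi_i).$$
   Context: A matrix $P\in\mathbb{R}^{d\times d}$ is stochastic if its entries are non-negative and each column sums to $1$ (column convention: $P_{ij}$ is the probability of moving from state $j$ to state $i$). An initial distribution is a vector with non-negative entries summing to $1$. The mean payoff is $\mathcal{MP}_w(P,\iota)=\lim_{n\to\infty}\frac1n\sum_{k=0}^{n-1}w(P^k\iota)$. *)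

(* Defs.v *)
From HB Require Import structures.
From mathcomp Require Import all_boot all_order all_algebra.
From mathcomp Require Import all_classical all_reals all_analysis.

Set Implicit Arguments.
Unset Strict Implicit.
Unset Printing Implicit Defensive.
Import Order.TTheory GRing.Theory Num.Theory.
Import numFieldNormedType.Exports.
Local Open Scope classical_set_scope.
Local Open Scope ring_scope.

(* Model of computation: first-order functional programs over binary trees,
   with call-by-value evaluation and unit cost per evaluated construct (the
   language F of N. D. Jones, Computability and Complexity from a Programming
   Perspective, with several functions, and with pattern matching in place of
   hd and tl).  Only constant-time pointer operations are charged 1 ([ECons]
   shares its arguments, and there is no test for equality of trees), so running
   times agree with those of Turing machines up to a polynomial.  Despite
   sharing, a list built in t steps is at most t longer than those it started
   from. *)

Inductive tree := Leaf | Node of tree & tree.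

(* Variables are de Bruijn indices.  In [EMatch e a b] the branch [b] binds the
   left subtree as variable 0 and the right subtree as variable 1. *)
Inductive expr :=
  | EVar of nat
  | ENil
  | ECons of expr & expr
  | ELet of expr & expr
  | EMatch of expr & expr & expr
  | ECall of nat & expr.

(* The bodies of the functions 0, 1, 2, etc.; each function has one argument,
   which is variable 0 of its body.  Function 0 is the entry point. *)
Definition program := seq expr.

(* [evaluates M env e v t]: the evaluation of e terminates with value v after
   exactly t steps. *)
Inductive evaluates (M : program) : seq tree -> expr -> tree -> nat -> Prop :=
  | EvalVar env i : evaluates M env (EVar i) (nth Leaf env i) 1
  | EvalNil env : evaluates M env ENil Leaf 1
  | EvalCons env a b u v m n :
      evaluates M env a u m -> evaluates M env b v n ->
      evaluates M env (ECons a b) (Node u v) (m + n).+1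
  | EvalLet env a b u v m n :
      evaluates M env a u m -> evaluates M (u :: env) b v n ->
      evaluates M env (ELet a b) v (m + n).+1
  | EvalMatchLeaf env e a b v m n :
      evaluates M env e Leaf m -> evaluates M env a v n ->
      evaluates M env (EMatch e a b) v (m + n).+1
  | EvalMatchNode env e a b x y v m n :
      evaluates M env e (Node x y) m -> evaluates M [:: x, y & env] b v n ->
      evaluates M env (EMatch e a b) v (m + n).+1
  | EvalCall env f a u v m n :
      evaluates M env a u m -> evaluates M [:: u] (nth ENil M f) v n ->
      evaluates M env (ECall f a) v (m + n).+1.

Definition outputs_within (M : program) (input output : tree) (T : nat) : Prop :=
  exists2 t, evaluates M [:: input] (nth ENil M 0) output t & (t <= T)%N.

(* Binary expansion, least significant bit first, without leading zeros. *)
Fixpoint pos_bits (p : BinNums.positive) : seq bool :=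
  match p with
  | BinNums.xH => [:: true]
  | BinNums.xO p => false :: pos_bits p
  | BinNums.xI p => true :: pos_bits p
  end.

Definition bits (n : nat) : seq bool :=
  if bin_of_nat n is BinNums.Npos p then pos_bits p else [::].

Definition enc_seq (T : Type) (enc : T -> tree) (s : seq T) : tree :=
  foldr (fun x t => Node (enc x) t) Leaf s.

Definition enc_bool (b : bool) : tree := if b then Node Leaf Leaf else Leaf.

Definition enc_nat (n : nat) : tree := enc_seq enc_bool (bits n).

Definition enc_int (z : int) : tree := Node (enc_bool (z < 0)) (enc_nat `|z|%N).

(* Numerator and denominator in lowest terms. *)
Definition enc_rat (q : rat) : tree :=
  Node (enc_int (numq q)) (enc_nat `|denq q|%N).

Definition enc_vec (d : nat) (v : 'cV[rat]_d) : tree :=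
  enc_seq (fun i => enc_rat (v i 0)) (enum 'I_d).

Definition enc_mx (d : nat) (A : 'M[rat]_d) : tree :=
  enc_seq (fun i => enc_seq (fun j => enc_rat (A i j)) (enum 'I_d)) (enum 'I_d).

Definition enc_input (d : nat) (P : 'M[rat]_d) (iota : 'cV[rat]_d) : tree :=
  Node (enc_mx P) (enc_vec iota).

Definition enc_points (d l : nat) (pts : 'I_l -> 'cV[rat]_d) : tree :=
  enc_seq (fun i => enc_vec (pts i)) (enum 'I_l).

(* One bit for the sign. *)
Definition rat_bitlen (q : rat) : nat :=
  (1 + size (bits `|numq q|) + size (bits `|denq q|))%N.

Definition input_bitlen (d : nat) (P : 'M[rat]_d) (iota : 'cV[rat]_d) : nat :=
  (\sum_(i < d) \sum_(j < d) rat_bitlen (P i j)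
   + \sum_(i < d) rat_bitlen (iota i ord0))%N.

(* Column convention: [P i j] is the probability of moving from j to i. *)
Definition stochastic (K : numDomainType) (d : nat) (P : 'M[K]_d) : Prop :=
  (forall i j, 0 <= P i j) /\ (forall j, \sum_(i < d) P i j = 1).

Definition initial_distribution (K : numDomainType) (d : nat) (v : 'cV[K]_d) : Prop :=
  (forall i, 0 <= v i 0) /\ \sum_(i < d) v i 0 = 1.

Definition payoff_average (R : realType) (d : nat) (w : 'cV[R]_d -> R)
    (P : 'M[R]_d) (iota : 'cV[R]_d) : R^nat :=
  fun n => n%:R^-1 * \sum_(0 <= k < n) w (P ^+ k *m iota).

(* [lim] has an arbitrary value on divergent sequences, so statements about
   [mean_payoff] should come with convergence of [payoff_average]. *)
Definition mean_payoff (R : realType) (d : nat) (w : 'cV[R]_d -> R)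
    (P : 'M[R]_d) (iota : 'cV[R]_d) : R :=
  limn (payoff_average w P iota).

(* Main.v *)
Require Import Defs.
From HB Require Import structures.
From mathcomp Require Import all_boot all_order all_algebra.
From mathcomp Require Import perm algC.
From mathcomp Require Import all_classical all_reals all_analysis.
From mathcomp Require Import zify ring.

Set Implicit Arguments.
Unset Strict Implicit.
Unset Printing Implicit Defensive.
Import Order.TTheory GRing.Theory Num.Theory.
Import numFieldNormedType.Exports.
Local Open Scope classical_set_scope.
Local Open Scope ring_scope.

(** With l = d!, the powers Q^k of Q = P^l converge: an eigenvalue z of P satisfies
    |z| <= 1, and if |z| = 1 then a left eigenvector has constant modulus along the
    paths of the chain that start where its modulus is largest, so that following a
    path until it closes a cycle gives z^k = 1 for some 0 < k <= d.  As the powers of P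
    are bounded, 1 is a semisimple eigenvalue of Q; hence the limit E of Q^k is
    h(B) / h(0) for B = Q - 1 and char_poly B = X^m h with h(0) != 0, and the points
    are E P^i iota for i < l.

    After scaling to integers, h(B) iota and h(0) come from a division-free form of
    the Faddeev-LeVerrier recursion.  All numbers involved have O(d! poly(n)) bits, so,
    given d! in unary, everything runs in polynomial time; only the production of d! in
    unary takes exponential time.  The polynomial-time functions are closed under
    composition and bounded iteration, so no program has to be written out. *)

(** * Polynomial-time functions *)

Section Framework.
Local Open Scope nat_scope.

(** Taking l = d! requires no knowledge of the periods of P: it is a multiple of every k <= d and is
    at most d^d. Why h(B) / h(0) is the limit: Cayley-Hamilton gives B^m h(B) = 0, semisimplicity
    lowers this to B h(B) = 0, so its image is fixed by Q; and h(B) / h(0) - 1 is a multiple of B,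
    on whose image the powers of P tend to 0. Two obstacles shape the proof. Eigenvalues are in
    general irrational, but only their moduli matter and only for convergence: the roots are split
    by modulus over an algebraically closed field and the conclusion is carried back to the
    rationals, while the program sees nothing but coefficients of a characteristic polynomial.
    Secondly, iterating a polynomial-time map can double the length of its value in every round.
    Iteration therefore demands an a priori bound on the accumulator, and each integer loop is
    arranged so that a round adds a number of bits independent of the current value. For this reason
    points are kept as integer vectors with a separate integer denominator and are reduced only at
    the very end. *)

Fixpoint tsize (t : tree) : nat :=
  if t is Node a b then (tsize a + tsize b).+1 else 1.

(** Bundling a type with its encoding as a canonical structure lets unification find the encodings,
    so that membership in [FP] is stated for ordinary functions. *)
Structure encType := EncType { enc_sort :> Type; enc_of : enc_sort -> tree }.

Definition enc (A : encType) : A -> tree := @enc_of A.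

Canonical unit_encType := @EncType unit (fun=> Leaf).
Canonical bool_encType := @EncType bool enc_bool.
Canonical nat_encType := @EncType nat enc_nat.
Canonical int_encType := @EncType int enc_int.
Canonical rat_encType := @EncType rat enc_rat.
Canonical prod_encType (A B : encType) :=
  @EncType (A * B) (fun p => Node (enc p.1) (enc p.2)).
Canonical seq_encType (A : encType) := @EncType (seq A) (enc_seq (@enc A)).

Definition esize (A : encType) (x : A) := tsize (enc x).

Arguments enc : simpl never.
Arguments esize : simpl never.

Lemma enc_pair (A B : encType) (x : A) (y : B) : enc (x, y) = Node (enc x) (enc y).
Proof. by []. Qed.

Lemma esize_pair (A B : encType) (x : A) (y : B) :
  esize (x, y) = (esize x + esize y).+1.
Proof. by []. Qed.

(** The base is at least 2, so constant factors and sums are absorbed by a larger exponent, and the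
    single number [k] describes the bound. *)
Definition polybounded (p : nat -> nat) :=
  exists k, forall n, p n <= (n + 2) ^ k.

Lemma polybounded_const c : polybounded (fun=> c).
Proof.
exists c => n; apply: leq_trans (ltnW (ltn_expl c (ltnSn 1))) _.
by case: c => // c; rewrite leq_exp2r // leq_addl.
Qed.

Lemma polybounded_id : polybounded (fun n => n).
Proof. by exists 1 => n; rewrite expn1 leq_addr. Qed.

Lemma polyboundedD p q :
  polybounded p -> polybounded q -> polybounded (fun n => p n + q n).
Proof.
move=> [k hp] [m hq]; exists (maxn k m).+1 => n.
rewrite expnS; apply: (@leq_trans (2 * (n + 2) ^ maxn k m)).
  rewrite mul2n -addnn; apply: leq_add.
    by apply: leq_trans (hp n) _; rewrite leq_pexp2l ?addn2 ?leq_maxl.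
  by apply: leq_trans (hq n) _; rewrite leq_pexp2l ?addn2 ?leq_maxr.
by rewrite leq_mul2r leq_addl orbT.
Qed.

Lemma polyboundedM p q :
  polybounded p -> polybounded q -> polybounded (fun n => p n * q n).
Proof.
move=> [k hp] [m hq]; exists (k + m) => n.
by rewrite expnD leq_mul.
Qed.

Lemma polyboundedX p k : polybounded p -> polybounded (fun n => p n ^ k).
Proof.
move=> [m hp]; exists (m * k) => n; rewrite expnM.
by case: k => // k; rewrite leq_exp2r.
Qed.

Lemma polyboundedS p : polybounded p -> polybounded (fun n => (p n).+1).
Proof.
move=> hp; have [k hk] := polyboundedD hp (polybounded_const 1).
by exists k => n; rewrite -addn1.
Qed.

Definition evaluates_within (G : program) env e v T :=
  exists2 t, evaluates G env e v t & t <= T.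

Lemma within_le G env e v T T' :
  evaluates_within G env e v T -> T <= T' -> evaluates_within G env e v T'.
Proof. by move=> [t et lt] le; exists t => //; apply: leq_trans le. Qed.

Lemma within_var G env i v : nth Leaf env i = v ->
  evaluates_within G env (EVar i) v 1.
Proof. by move=> <-; exists 1 => //; apply: EvalVar. Qed.

Lemma within_nil G env : evaluates_within G env ENil Leaf 1.
Proof. by exists 1 => //; apply: EvalNil. Qed.

Lemma within_cons G env a b u v m n :
  evaluates_within G env a u m -> evaluates_within G env b v n ->
  evaluates_within G env (ECons a b) (Node u v) (m + n).+1.
Proof.
move=> [s es ls] [t et lt]; exists (s + t).+1; first exact: EvalCons.
by rewrite ltnS leq_add.
Qed.

Lemma within_let G env a b u v m n :
  evaluates_within G env a u m -> evaluates_within G (u :: env) b v n ->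
  evaluates_within G env (ELet a b) v (m + n).+1.
Proof.
move=> [s es ls] [t et lt]; exists (s + t).+1; first exact: EvalLet es et.
by rewrite ltnS leq_add.
Qed.

Lemma within_match_leaf G env e a b v m n :
  evaluates_within G env e Leaf m -> evaluates_within G env a v n ->
  evaluates_within G env (EMatch e a b) v (m + n).+1.
Proof.
move=> [s es ls] [t et lt]; exists (s + t).+1; first exact: EvalMatchLeaf.
by rewrite ltnS leq_add.
Qed.

Lemma within_match_node G env e a b x y v m n :
  evaluates_within G env e (Node x y) m ->
  evaluates_within G [:: x, y & env] b v n ->
  evaluates_within G env (EMatch e a b) v (m + n).+1.
Proof.
move=> [s es ls] [t et lt]; exists (s + t).+1.
  exact: EvalMatchNode es et.
by rewrite ltnS leq_add.
Qed.

Lemma within_call G env f a u v m n :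
  evaluates_within G env a u m ->
  evaluates_within G [:: u] (nth ENil G f) v n ->
  evaluates_within G env (ECall f a) v (m + n).+1.
Proof.
move=> [s es ls] [t et lt]; exists (s + t).+1; first exact: EvalCall es et.
by rewrite ltnS leq_add.
Qed.

Definition eFst i := EMatch (EVar i) ENil (EVar 0).
Definition eSnd i := EMatch (EVar i) ENil (EVar 1).

Lemma within_fst G env i x y : nth Leaf env i = Node x y ->
  evaluates_within G env (eFst i) x 3.
Proof. by move=> h; apply: within_match_node (within_var _ h) (within_var _ _). Qed.

Lemma within_snd G env i x y : nth Leaf env i = Node x y ->
  evaluates_within G env (eSnd i) y 3.
Proof. by move=> h; apply: within_match_node (within_var _ h) (within_var _ _). Qed.

(** Calls name functions by absolute index, so the code of a combined function has to be generated
    for the position of each of its blocks. *)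
Definition placed (G : program) b (c : seq expr) :=
  forall i, i < size c -> nth ENil G (b + i) = nth ENil c i.

Lemma placed_cat G b c1 c2 : placed G b (c1 ++ c2) ->
  placed G b c1 /\ placed G (b + size c1) c2.
Proof.
move=> h; split=> i hi.
  by rewrite h ?size_cat ?ltn_addr // nth_cat hi.
by rewrite -addnA h ?size_cat ?ltn_add2l // nth_cat ltnNge leq_addr /= addKn.
Qed.

(* The code of a function may be placed at any offset [b] of a larger program
   [G], and reads its argument in variable 0 of an arbitrary environment. *)
Definition FP (A B : encType) (f : A -> B) : Prop :=
  exists (c : nat -> seq expr) (sz : nat) (e : nat -> expr) (k : nat),
    (forall b, size (c b) = sz) /\
    forall G b, placed G b (c b) -> forall x env,
      evaluates_within G (enc x :: env) (e b) (enc (f x)) ((esize x + 2) ^ k)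
      /\ esize (f x) <= (esize x + 2) ^ k.

Lemma FP_intro (A B : encType) (f : A -> B) c sz e (p : nat -> nat) :
  (forall b : nat, size (c b) = sz) -> polybounded p ->
  (forall G b, placed G b (c b) -> forall x env,
      evaluates_within G (enc x :: env) (e b) (enc (f x)) (p (esize x))
      /\ esize (f x) <= p (esize x)) -> FP f.
Proof.
move=> hsz [k hk] h; exists c, sz, e, k; split=> // G b hp x env.
have [h1 h2] := h G b hp x env; split; first exact: within_le h1 _.
exact: leq_trans h2 _.
Qed.

Lemma FP_ext (A B : encType) (f g : A -> B) : f =1 g -> FP f -> FP g.
Proof.
move=> fg [c [sz [e [k [hsz h]]]]]; exists c, sz, e, k; split=> // G b hp x env.
by rewrite -fg; apply: h.
Qed.

(** Reading the same tree as a value of another type is free. The digits of a number, the sign and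
    absolute value of an integer and the two parts of a fraction are obtained in this way. *)
Lemma FP_recode (A B : encType) (f : A -> B) :
  (forall x, enc (f x) = enc x) -> FP f.
Proof.
move=> h; apply: (@FP_intro _ _ f (fun=> [::]) 0 (fun=> EVar 0) (fun n => n.+1)) => //.
  exact: polyboundedS polybounded_id.
move=> G b _ x env; rewrite /esize h; split=> //.
by apply: within_le (within_var _ _) _.
Qed.

Lemma FP_id (A : encType) : FP (fun x : A => x).
Proof. exact: FP_recode. Qed.

(** The code of [g] runs with the value of [f] pushed on the environment, which is why [FP] allows
    an arbitrary tail there. The size bound in [FP] turns the running time of [g] into a polynomial
    in the original input. *)
Lemma FP_comp (A B C : encType) (f : A -> B) (g : B -> C) :
  FP f -> FP g -> FP (fun x => g (f x)).
Proof.
move=> [c1 [s1 [e1 [k1 [hs1 h1]]]]] [c2 [s2 [e2 [k2 [hs2 h2]]]]].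
apply: (@FP_intro _ _ _ (fun b => c1 b ++ c2 (b + s1)) (s1 + s2)
   (fun b => ELet (e1 b) (e2 (b + s1)))
   (fun n => ((n + 2) ^ k1 + ((n + 2) ^ k1 + 2) ^ k2).+1)) => [b||G b].
- by rewrite size_cat hs1 hs2.
- by apply: polyboundedS; do ?[apply: polyboundedD|apply: polyboundedX|
    exact: polybounded_const|exact: polybounded_id].
move=> /placed_cat []; rewrite hs1 => p1 p2 x env.
have [w1 z1] := h1 _ _ p1 x env.
have [w2 z2] := h2 _ _ p2 (f x) (enc x :: env).
have le : (esize (f x) + 2) ^ k2 <= ((esize x + 2) ^ k1 + 2) ^ k2.
  by case: (k2) => // k; rewrite leq_exp2r // leq_add2r.
split; last by apply: leq_trans z2 _; lia.
apply: within_le (within_let w1 w2) _; lia.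
Qed.

Lemma FP_pair (A B C : encType) (f : A -> B) (g : A -> C) :
  FP f -> FP g -> FP (fun x => (f x, g x)).
Proof.
move=> [c1 [s1 [e1 [k1 [hs1 h1]]]]] [c2 [s2 [e2 [k2 [hs2 h2]]]]].
apply: (@FP_intro _ _ _ (fun b => c1 b ++ c2 (b + s1)) (s1 + s2)
   (fun b => ECons (e1 b) (e2 (b + s1)))
   (fun n => ((n + 2) ^ k1 + (n + 2) ^ k2).+1)) => [b||G b].
- by rewrite size_cat hs1 hs2.
- by apply: polyboundedS; do ?[apply: polyboundedD|apply: polyboundedX|
    exact: polybounded_const|exact: polybounded_id].
move=> /placed_cat []; rewrite hs1 => p1 p2 x env.
have [w1 z1] := h1 _ _ p1 x env.
have [w2 z2] := h2 _ _ p2 x env.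
by split; [exact: within_cons w1 w2 | rewrite esize_pair ltnS leq_add].
Qed.

Lemma FP_fst (A B C : encType) (f : A -> B * C) :
  FP f -> FP (fun x => (f x).1).
Proof.
move=> hf; apply: (FP_comp (g := fun p => p.1) hf).
apply: (@FP_intro _ _ _ (fun=> [::]) 0 (fun=> eFst 0) (fun n => n + 3)) => //.
  exact: polyboundedD polybounded_id (polybounded_const _).
move=> G b _ [x y] env; split; last by rewrite esize_pair /=; lia.
by apply: within_le; [apply: within_fst | rewrite leq_addl].
Qed.

Lemma FP_snd (A B C : encType) (f : A -> B * C) :
  FP f -> FP (fun x => (f x).2).
Proof.
move=> hf; apply: (FP_comp (g := fun p => p.2) hf).
apply: (@FP_intro _ _ _ (fun=> [::]) 0 (fun=> eSnd 0) (fun n => n + 3)) => //.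
  exact: polyboundedD polybounded_id (polybounded_const _).
move=> G b _ [x y] env; split; last by rewrite esize_pair /=; lia.
by apply: within_le; [apply: within_snd | rewrite leq_addl].
Qed.

Fixpoint eTree (t : tree) : expr :=
  if t is Node a b then ECons (eTree a) (eTree b) else ENil.

Lemma within_tree G env t : evaluates_within G env (eTree t) t (tsize t).
Proof.
elim: t => [|a IHa b IHb] /=; first exact: within_nil.
exact: within_cons.
Qed.

Lemma FP_const (A B : encType) (y : B) : FP (fun _ : A => y).
Proof.
apply: (@FP_intro _ _ _ (fun=> [::]) 0 (fun=> eTree (enc y)) (fun=> esize y)) => //.
  exact: polybounded_const.
by move=> G b _ x env; split=> //; apply: within_tree.
Qed.

(** Case analysis on booleans and on lists both reduce to this; they differ only in how the two
    subtrees are decoded as [yz]. The result [r] is kept abstract so that it need not be written as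
    a match on trees. *)
Lemma FP_match (A B Y Z D : encType) (s : A -> B) (f : A -> D) (g : A * (Y * Z) -> D)
    (r : A -> D) :
  FP s -> FP f -> FP g ->
  (forall x, if enc (s x) is Node u v
             then exists2 yz : Y * Z, enc yz = Node u v & r x = g (x, yz)
             else r x = f x) ->
  FP r.
Proof.
move=> [c0 [s0 [e0 [k0 [hs0 h0]]]]] [c1 [s1 [e1 [k1 [hs1 h1]]]]].
move=> [c2 [s2 [e2 [k2 [hs2 h2]]]]] hr.
apply: (@FP_intro _ _ _
   (fun b => c0 b ++ (c1 (b + s0) ++ c2 (b + s0 + s1))) (s0 + (s1 + s2))
   (fun b => EMatch (e0 b) (e1 (b + s0))
      (ELet (ECons (EVar 2) (ECons (EVar 0) (EVar 1))) (e2 (b + s0 + s1))))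
   (fun n => (n + 2) ^ k0 + (n + 2) ^ k1 + (n + (n + 2) ^ k0 + 3) ^ k2 + 10)) => [b||G b].
- by rewrite !size_cat hs0 hs1 hs2.
- by do ?[apply: polyboundedD|apply: polyboundedX|
    exact: polybounded_const|exact: polybounded_id].
move=> /placed_cat [p0 /placed_cat[]]; rewrite hs0 hs1 => p1 p2 x env.
have [w0 z0] := h0 _ _ p0 x env.
have [w1 z1] := h1 _ _ p1 x env.
have := hr x; case E : (enc (s x)) => [|u v].
  move=> ->; split; last by lia.
  rewrite E in w0; apply: within_le (within_match_leaf _ w0 w1) _; lia.
case=> yz Eyz ->.
have [w2 z2] := h2 _ _ p2 (x, yz) [:: u, v, enc x & env].
have le : (esize (x, yz) + 2) ^ k2 <= (esize x + (esize x + 2) ^ k0 + 3) ^ k2.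
  have -> : esize (x, yz) = (esize x + esize (s x)).+1.
    by rewrite esize_pair {2}/esize Eyz -E.
  by case: (k2) => // k; rewrite leq_exp2r; lia.
split; last by lia.
rewrite E in w0.
have w3 : evaluates_within G [:: u, v, enc x & env]
    (ECons (EVar 2) (ECons (EVar 0) (EVar 1))) (enc (x, yz)) 5.
  rewrite enc_pair Eyz.
  exact: within_cons (within_var _ _) (within_cons (within_var _ _) (within_var _ _)).
apply: within_le (within_match_node _ w0 (within_let w3 w2)) _ => //.
lia.
Qed.

Lemma FP_if (A B : encType) (c : A -> bool) (f g : A -> B) :
  FP c -> FP f -> FP g -> FP (fun x => if c x then f x else g x).
Proof.
move=> hc hf hg.
(* [true] is the node of two leaves, hence the encoding of [(tt, tt)]. *)
apply: (@FP_match A _ unit_encType unit_encType _ c g (fun p => f p.1)) => //.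
  exact: FP_comp (FP_fst (FP_id _)) hf.
by move=> x; case: (c x) => //; exists (tt, tt).
Qed.

Lemma esize_cons (A : encType) (x : A) s : esize (x :: s) = (esize x + esize s).+1.
Proof. by []. Qed.

Lemma size_esize (A : encType) (s : seq A) : size s <= esize s.
Proof. by elim: s => //= x s IH; rewrite esize_cons; lia. Qed.

(** The bound [S] on all intermediate accumulators is a parameter, not a polynomial in the input, so
    that the result also covers the loop producing a factorial in unary, where [S] is
    exponential. *)
Lemma fold_within (C A X : encType) (step : C * A * X -> A) :
  FP step ->
  exists (c : nat -> seq expr) (sz : nat) (e : nat -> expr) (k : nat),
    (forall b, size (c b) = sz) /\
    forall G b, placed G b (c b) -> forall (c0 : C) (a0 : A) (s : seq X) S env,
      (forall i, esize (foldl (fun a x => step (c0, a, x)) a0 (take i s)) <= S) ->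
      esize c0 <= S -> esize s <= S ->
      evaluates_within G (enc (c0, a0, s) :: env) (e b)
        (enc (foldl (fun a x => step (c0, a, x)) a0 s)) ((S + 2) ^ k).
Proof.
move=> [c1 [s1 [e1 [k1 [hs1 h1]]]]].
(* Function [b] is a tail-recursive loop on a tree made of context, accumulator and remaining list;
   the code of [step] follows it, from index [b.+1]. *)
pose body b := EMatch (eSnd 0) (ELet (eFst 0) (eSnd 0))
  (ECall b (ECons (ELet (eFst 2) (ECons (eFst 0)
     (ELet (ECons (EVar 0) (EVar 1)) (e1 b.+1)))) (EVar 1))).
(* The argument of [step] has size at most 3 S + 2; 30 pays for the constant part of a round and 5
   for the initial call. *)
have [k hk] : polybounded (fun S => (S + 1) * ((3 * S + 4) ^ k1 + 30) + 5).
  by do ?[apply: polyboundedD|apply: polyboundedM|apply: polyboundedX|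
    exact: polybounded_const|exact: polybounded_id].
exists (fun b => body b :: c1 b.+1), s1.+1, (fun b => ECall b (EVar 0)), k.
split=> [b|G b hp c0 a0 s S env ha hc hs]; first by rewrite /= hs1.
have hb : nth ENil G b = body b by have := hp 0 isT; rewrite addn0.
have p1 : placed G b.+1 (c1 b.+1).
  by move=> i hi; have := hp i.+1 hi; rewrite addSnnS.
apply: (within_le _ (hk S)).
have loop : evaluates_within G [:: enc (c0, a0, s)] (body b)
   (enc (foldl (fun a x => step (c0, a, x)) a0 s))
   ((size s).+1 * ((3 * S + 4) ^ k1 + 30)).
  clear env.
  elim: s a0 ha hs => [|x s IH] a0 ha hs.
    have w1 : evaluates_within G [:: enc (c0, a0, @nil X)] (eSnd 0) Leaf 3 by exact: within_snd.
    have w2 : evaluates_within G [:: enc (c0, a0, @nil X)] (eFst 0) (enc (c0, a0)) 3 by exact: within_fst.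
    have w3 : evaluates_within G [:: enc (c0, a0); enc (c0, a0, @nil X)] (eSnd 0) (enc a0) 3 by exact: within_snd.
    apply: within_le (within_match_leaf _ w1 (within_let w2 w3)) _ => /=; lia.
  have hx : esize x <= S by rewrite esize_cons in hs; lia.
  set arg := enc (c0, a0, x :: s).
  have [ws _] := h1 _ _ p1 (c0, a0, x) [:: enc (c0, a0); enc x; enc s; arg].
  have hle : (esize (c0, a0, x) + 2) ^ k1 <= (3 * S + 4) ^ k1.
    have := ha 0; rewrite take0 /= => ha0.
    have : esize (c0, a0, x) + 2 <= 3 * S + 4.
      by rewrite !esize_pair; lia.
    by case: (k1) => // k2; rewrite leq_exp2r.
  have hs' : esize s <= S by rewrite esize_cons in hs; lia.
  have {IH}wl := IH (step (c0, a0, x)) (fun i => ha i.+1) hs'.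
  rewrite -hb in wl.
  have v1 : evaluates_within G [:: arg] (eSnd 0) (Node (enc x) (enc s)) 3 by exact: within_snd.
  have v2 : evaluates_within G [:: enc x; enc s; arg] (eFst 2) (enc (c0, a0)) 3 by exact: within_fst.
  have v3 : evaluates_within G [:: enc (c0, a0); enc x; enc s; arg] (eFst 0) (enc c0) 3 by exact: within_fst.
  have v4 : evaluates_within G [:: enc (c0, a0); enc x; enc s; arg] (ECons (EVar 0) (EVar 1))
    (enc (c0, a0, x)) 3 by apply: (within_cons (within_var _ _) (within_var _ _)).
  have v5 : evaluates_within G [:: enc x; enc s; arg] (EVar 1) (enc s) 1 by exact: within_var.
  have v6 := within_cons (within_let v2 (within_cons v3 (within_let v4 ws))) v5.
  apply: within_le (within_match_node _ v1 (within_call v6 wl)) _ => /=.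
  by rewrite mulSnr; lia.
rewrite -hb in loop.
have v : evaluates_within G (enc (c0, a0, s) :: env) (EVar 0) (enc (c0, a0, s)) 1.
  exact: within_var.
apply: within_le (within_call v loop) _.
have h := size_esize s.
have : (size s).+1 * ((3 * S + 4) ^ k1 + 30) <= (S + 1) * ((3 * S + 4) ^ k1 + 30).
  by rewrite leq_mul2r; apply/orP; right; lia.
lia.
Qed.

End Framework.

Ltac polyb :=
  lazymatch goal with
  | |- polybounded (fun n => n) => exact: polybounded_id
  | |- polybounded id => exact: polybounded_id
  | |- polybounded (fun n => S (@?p n)) => apply: polyboundedS; polyb
  | |- polybounded (fun n => addn (@?p n) (@?q n)) => apply: polyboundedD; polyb
  | |- polybounded (fun n => muln (@?p n) (@?q n)) => apply: polyboundedM; polyb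
  | |- polybounded (fun n => expn (@?p n) ?k) => apply: polyboundedX; polyb
  | |- polybounded S => exact: (polyboundedS polybounded_id)
  | |- polybounded (muln ?c) =>
      exact: (polyboundedM (polybounded_const c) polybounded_id)
  | |- polybounded (addn ?c) =>
      exact: (polyboundedD (polybounded_const c) polybounded_id)
  | |- polybounded (fun n => ?c) => exact: polybounded_const
  end.

(** Hook of [fp], rebound as further operations are shown to be polynomial-time. *)
Ltac fp_op := fail.
(** The auxiliary goal only tests that the body is syntactically a conditional before [FP_if] is
    applied. *)
Ltac fp_if :=
  match goal with |- @FP ?A ?B ?f =>
    let H := fresh in
    assert (H : forall x : A, f x = f x) by
      (let x := fresh in intro x; cbv beta;
       lazymatch goal with |- (if _ then _ else _) = _ => reflexivity end);
    clear H; apply: FP_if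
  end.
Ltac fp1 :=
  lazymatch goal with
  | |- FP (fun x => x) => exact: FP_id
  | |- FP fst => exact: (FP_fst (FP_id _))
  | |- FP snd => exact: (FP_snd (FP_id _))
  | |- FP (fun x => fst (@?f x)) => apply: (FP_fst (f := f))
  | |- FP (fun x => snd (@?f x)) => apply: (FP_snd (f := f))
  | |- FP (fun x => (@?f x, @?g x)) => apply: (FP_pair (f := f) (g := g))
  | _ => first [exact: FP_const | fp_op | fp_if]
  end.
Ltac fp := cbv beta; repeat (fp1; cbv beta).

(** * Bounded iteration and list operations *)

Section Lists.
Local Open Scope nat_scope.

(** A prefix of a list is no larger than the list, so a bound on the final value for all inputs also
    bounds every intermediate accumulator. *)
Lemma FP_foldl_triple (C A X : encType) (step : C * A * X -> A) (p : nat -> nat) :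
  FP step -> polybounded p ->
  (forall c a s, esize (foldl (fun a x => step (c, a, x)) a s)
     <= p (esize c + esize a + esize s)) ->
  FP (fun t : C * A * seq X => foldl (fun a x => step (t.1.1, a, x)) t.1.2 t.2).
Proof.
move=> /fold_within [c [sz [e [k [hsz hk]]]]] [m hm] hp.
apply: (@FP_intro _ _ _ c sz e
  (fun n => (n + (n + 2) ^ m + 2) ^ k + (n + 2) ^ m)) => //; first by polyb.
move=> G b pl [[c0 a0] s] env /=.
have hs : esize c0 + esize a0 + esize s <= esize (c0, a0, s).
  by rewrite !esize_pair; lia.
have bnd s' : esize s' <= esize s ->
    esize (foldl (fun a x => step (c0, a, x)) a0 s') <= (esize (c0, a0, s) + 2) ^ m.
  move=> hle; apply: leq_trans (hp _ _ _) _; apply: leq_trans (hm _) _.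
  by case: (m) => // m'; rewrite leq_exp2r //; lia.
have take_le i : esize (take i s) <= esize s.
  elim: s {hs bnd} i => [|x s IH] [|i] //=; rewrite !esize_cons.
  by have := IH i; lia.
split; last by apply: leq_trans (bnd s (leqnn _)) _; rewrite leq_addl.
set n := esize (c0, a0, s) in hs bnd *.
apply: within_le (hk G b pl c0 a0 s (n + (n + 2) ^ m) env _ _ _) _.
- by move=> i; apply: leq_trans (bnd _ (take_le i)) _; rewrite leq_addl.
- by lia.
- by lia.
by rewrite leq_addr.
Qed.

Lemma FP_foldl (T C A X : encType) (step : C * A * X -> A) (p : nat -> nat)
    (c : T -> C) (a0 : T -> A) (s : T -> seq X) :
  FP step -> polybounded p ->
  (forall c a s, esize (foldl (fun a x => step (c, a, x)) a s)
     <= p (esize c + esize a + esize s)) ->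
  FP c -> FP a0 -> FP s ->
  FP (fun t => foldl (fun a x => step (c t, a, x)) (a0 t) (s t)).
Proof.
move=> h1 h2 h3 hc ha hs.
exact: (FP_comp (FP_pair (FP_pair hc ha) hs) (FP_foldl_triple h1 h2 h3)).
Qed.

Lemma FP_cons (T A : encType) (x : T -> A) s :
  FP x -> FP s -> FP (fun t => x t :: s t).
Proof.
move=> hx hs; apply: (FP_comp (FP_pair hx hs)
  (FP_recode (f := fun p : A * seq A => p.1 :: p.2) _)) => //.
Qed.

Lemma esize_cat (A : encType) (s t : seq A) :
  (esize (s ++ t)).+1 = esize s + esize t.
Proof.
by elim: s => [|x s IH]; rewrite ?cat_cons ?esize_cons ?add1n //; lia.
Qed.

Lemma esize_rev (A : encType) (s : seq A) : esize (rev s) = esize s.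
Proof.
elim: s => // x s IH; rewrite rev_cons -cats1.
have := esize_cat (rev s) [:: x]; rewrite IH !esize_cons.
by rewrite [esize (@nil A)]/esize /=; lia.
Qed.

Lemma FP_catrev (T A : encType) (s1 s2 : T -> seq A) :
  FP s1 -> FP s2 -> FP (fun t => catrev (s1 t) (s2 t)).
Proof.
move=> h1 h2.
have E t s : @foldl A (seq A) (fun a x => x :: a) s t = catrev t s.
  by elim: t s => //= x t IH s; rewrite IH.
apply: (@FP_ext _ _ (fun t => foldl (fun a x => x :: a) (s2 t) (s1 t))) => //.
apply: (@FP_foldl T unit_encType _ _ (fun q => q.2 :: q.1.2) (fun n => n) (fun=> tt)) => //.
- by apply: FP_cons; fp.
- by polyb.
- move=> c a s /=; rewrite E catrevE; have := esize_cat (rev s) a.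
  by rewrite esize_rev /esize /=; lia.
- by fp.
Qed.

Lemma FP_rev (T A : encType) (s : T -> seq A) :
  FP s -> FP (fun t => rev (s t)).
Proof. by move=> hs; apply: FP_catrev => //; fp. Qed.

Lemma FP_cat (T A : encType) (s1 s2 : T -> seq A) :
  FP s1 -> FP s2 -> FP (fun t => s1 t ++ s2 t).
Proof.
move=> h1 h2; apply: (@FP_ext _ _ (fun t => catrev (rev (s1 t)) (s2 t))).
  by move=> t; rewrite catrevE revK.
by apply: FP_catrev => //; apply: FP_rev.
Qed.

Lemma FP_map (T X B : encType) (h : T -> X -> B) s :
  FP (fun q : T * X => h q.1 q.2) -> FP s -> FP (fun t => map (h t) (s t)).
Proof.
move=> hh hs.
have E t s' a : foldl (fun a x => h t x :: a) a s' = catrev (map (h t) s') a.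
  by elim: s' a => //= x s' IH a; rewrite IH.
apply: (@FP_ext _ _ (fun t => rev (foldl (fun a x => h t x :: a) [::] (s t)))).
  by move=> t; rewrite E -/(rev _) revK.
apply: FP_rev; have [c [sz [e [k [_ hk]]]]] := hh.
have hk' t x : esize (h t x) <= (esize t + esize x + 3) ^ k.
  (* The size bound hidden in [FP] speaks of programs containing the code; the code itself, at
     offset 0, is such a program. *)
  pose G := c 0.
  have pl : placed G 0 (c 0) by move=> i _; rewrite add0n.
  have [_] := hk G 0 pl (t, x) [::].
  by rewrite esize_pair !addSn !addnS.
apply: (@FP_foldl T T _ _ (fun q => h q.1.1 q.2 :: q.1.2)
  (fun n => n + n * ((n + 3) ^ k).+1)) => //; [|polyb| |fp|fp].
  apply: FP_cons; last by fp.
  by apply: (FP_comp (f := fun q : T * seq B * X => (q.1.1, q.2)) _ hh); fp.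
move=> t a s'; cbv beta; rewrite E catrevE.
have := esize_cat (rev (map (h t) s')) a; rewrite esize_rev => Ecat.
suff : esize (map (h t) s') <= 1 + size s' * ((esize t + esize a + esize s' + 3) ^ k).+1.
  have : size s' * ((esize t + esize a + esize s' + 3) ^ k).+1 <=
    (esize t + esize a + esize s') * ((esize t + esize a + esize s' + 3) ^ k).+1.
    by rewrite leq_mul2r; have := size_esize s'; lia.
  by lia.
suff gen m s1 : esize s1 <= m ->
    esize (map (h t) s1) <= 1 + size s1 * ((esize t + esize a + m + 3) ^ k).+1.
  exact: gen.
elim: s1 => //= x s1 IH; rewrite !esize_cons => hle.
have {}IH := IH ltac:(lia).
have hx : (esize t + esize x + 3) ^ k <= (esize t + esize a + m + 3) ^ k.
  by case: (k) => // k'; rewrite leq_exp2r //; lia.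
by have := hk' t x; rewrite mulSn; lia.
Qed.

Lemma FP_match_seq (T Y D : encType) (s : T -> seq Y) (f : T -> D)
    (g : T -> Y -> seq Y -> D) :
  FP s -> FP f -> FP (fun q : T * (Y * seq Y) => g q.1 q.2.1 q.2.2) ->
  FP (fun t => if s t is y :: s' then g t y s' else f t).
Proof.
move=> hs hf hg; apply: (FP_match hs hf hg) => t.
by case: (s t) => [|y s'] //=; exists (y, s').
Qed.

Lemma FP_behead (T A : encType) (s : T -> seq A) :
  FP s -> FP (fun t => behead (s t)).
Proof.
move=> hs; apply: (@FP_ext _ _ (fun t => if s t is y :: s' then s' else [::])).
  by move=> t; case: (s t).
by apply: FP_match_seq => //; fp.
Qed.

Definition zip_step (X Y : Type) (q : seq Y * seq (X * Y)) (x : X) :=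
  if q.1 is y :: t then (t, (x, y) :: q.2) else q.

Lemma zip_foldl (X Y : Type) (s : seq X) (t : seq Y) a :
  (foldl (@zip_step X Y) (t, a) s).2 = catrev (zip s t) a.
Proof.
elim: s t a => [|x s IH] [|y t] a //=; last by rewrite IH.
by elim: s {IH}.
Qed.

Lemma FP_zip (T X Y : encType) (s1 : T -> seq X) (s2 : T -> seq Y) :
  FP s1 -> FP s2 -> FP (fun t => zip (s1 t) (s2 t)).
Proof.
move=> h1 h2.
apply: (@FP_ext _ _ (fun t => rev (foldl (@zip_step X Y) (s2 t, [::]) (s1 t)).2)).
  by move=> t; rewrite zip_foldl -/(rev _) revK.
apply: FP_rev; apply: FP_snd.
apply: (@FP_foldl T unit_encType _ _ (fun q => zip_step q.1.2 q.2)
  (fun n => n) (fun=> tt)) => //.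
- apply: (@FP_match_seq _ _ _ _ _ (fun q y t => (t, (q.2, y) :: q.1.2.2))).
  + by fp.
  + by fp.
  + by fp; apply: FP_cons; fp.
- by polyb.
- move=> c [t a] s; cbv beta.
  elim: s t a => [|x s IH] [|y t] a.
  + by rewrite /=; lia.
  + by rewrite /=; lia.
  + by apply: leq_trans (IH _ _) _; rewrite !esize_cons /zip_step /=; lia.
  + apply: leq_trans (IH _ _) _.
    rewrite /zip_step /= !esize_pair !esize_cons esize_pair; lia.
- by fp.
- by fp.
Qed.

End Lists.

(** * Arithmetic *)

Section Naturals.
Local Open Scope nat_scope.

(** Unlike in [FP_recode], the two functions share their argument and have equal output trees: a
    number may be computed as its digits, an integer as sign and absolute value, a rational as a
    pair. *)
Lemma FP_enc_eq (A B C : encType) (g : A -> C) (f : A -> B) :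
  (forall x, enc (f x) = enc (g x)) -> FP g -> FP f.
Proof.
move=> fg [c [sz [e [k [hsz h]]]]]; exists c, sz, e, k; split=> // G b hp x env.
by rewrite /esize !fg; apply: h.
Qed.

Lemma size_esize_bits (s : seq bool) : size s <= esize s.
Proof. exact: size_esize. Qed.

Lemma bits_pos p : bits (nat_of_pos p) = pos_bits p.
Proof. by rewrite /bits -[nat_of_pos p]/(nat_of_bin (BinNums.Npos p)) nat_of_binK. Qed.

Lemma bits_cons (b : bool) n : b || (n != 0) -> bits (b + n.*2) = b :: bits n.
Proof.
case: n => [|n]; first by case: b.
move=> _; have [p <-] : exists p, nat_of_pos p = n.+1.
  have := bin_of_natK n.+1; case: (bin_of_nat n.+1) => // p /= hp.
  by exists p.
have E : (b + (nat_of_pos p).*2)%N =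
   nat_of_pos (if b then BinNums.xI p else BinNums.xO p).
  by case: b => /=; rewrite NatTrec.doubleE.
by rewrite E !bits_pos; case: b {E}.
Qed.

Lemma bitsE n : bits n = if n == 0 then [::] else odd n :: bits n./2.
Proof.
case: eqP => [->//|/eqP n0]; rewrite -{1}(odd_double_half n) bits_cons //.
by case: n n0 => [|[|n]] //= _; rewrite orbT.
Qed.

Lemma ltn_bits n : n < 2 ^ size (bits n).
Proof.
have [m] := ubnP n; elim: m n => // m IH n hn.
rewrite bitsE; case: eqP => [->//|/eqP n0] /=.
rewrite -{1}(odd_double_half n) expnS.
have := IH n./2 ltac:(lia); lia.
Qed.

Lemma size_bits_le n b : n < 2 ^ b -> size (bits n) <= b.
Proof.
elim: b n => [|b IH] n; first by rewrite expn0; case: n.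
rewrite expnS bitsE; case: eqP => // _ h /=; rewrite ltnS; apply: IH; lia.
Qed.

(** A digit 1 is a tree of size 3 and its list cell adds 1, whence the factor 4. *)
Lemma esize_nat_le n b : n < 2 ^ b -> esize n <= 4 * b + 1.
Proof.
move=> /size_bits_le h; apply: (@leq_trans (4 * size (bits n) + 1)); last by lia.
rewrite /esize /enc /= /enc_nat.
elim: (bits n) => //= -[] s /=; lia.
Qed.

Lemma ltn_esize n : n < 2 ^ esize n.
Proof.
apply: leq_trans (ltn_bits n) _; rewrite leq_pexp2l //.
exact: size_esize_bits.
Qed.

(** [esize] itself is not monotone, because a digit 0 has a smaller tree than a digit 1; the factor
    4 compensates. *)
Lemma esize_nat_mono m n : m <= n -> esize m <= 4 * esize n + 1.
Proof. by move=> h; apply: esize_nat_le; apply: leq_ltn_trans h (ltn_esize n). Qed.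

Lemma FP_bits (T : encType) (n : T -> nat) : FP n -> FP (fun t => bits (n t)).
Proof. by move=> h; apply: (FP_comp h (FP_recode _)). Qed.

Lemma FP_odd (T : encType) (n : T -> nat) : FP n -> FP (fun t => odd (n t)).
Proof.
move=> h; apply: (@FP_ext _ _ (fun t => if bits (n t) is b :: s then b else false)).
  move=> t; rewrite bitsE; case: eqP => [->|] //.
by apply: FP_match_seq; [exact: FP_bits|fp|fp].
Qed.

Lemma FP_half (T : encType) (n : T -> nat) : FP n -> FP (fun t => (n t)./2).
Proof.
move=> h; apply: (FP_enc_eq (g := fun t => behead (bits (n t)))).
  by move=> t; rewrite [in RHS]bitsE; case: eqP => [->|].
by apply: FP_behead; apply: FP_bits.
Qed.

Lemma FP_eq0 (T : encType) (n : T -> nat) : FP n -> FP (fun t => n t == 0).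
Proof.
move=> h; apply: (@FP_ext _ _ (fun t => if bits (n t) is b :: s then false else true)).
  by move=> t; rewrite bitsE; case: eqP.
by apply: FP_match_seq; [exact: FP_bits|fp|fp].
Qed.

Lemma FP_bit_double (T : encType) (b : T -> bool) (n : T -> nat) :
  FP b -> FP n -> FP (fun t => b t + (n t).*2).
Proof.
move=> hb hn.
(* The guard prevents a leading zero: the number 0 has no digits. *)
apply: (FP_enc_eq (g := fun t => if (if b t then true else if n t == 0 then false else true)
  then b t :: bits (n t) else [::])).
  move=> t; case: ifP => h.
    by rewrite {1}/enc /= /enc_nat bits_cons.
  by case: (b t) h; case: (n t).
apply: FP_if => //; last by fp.
- by fp => //; apply: FP_eq0.
- by apply: FP_cons => //; apply: FP_bits.
Qed.

(** Digits are read from the highest one. Leading zeros are harmless here, so this also normalizes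
    the digit lists that the arithmetic loops produce. *)
Definition horner2 (n : nat) (s : seq bool) := foldl (fun n (b : bool) => b + n.*2) n s.

Lemma horner2_cat n s t : horner2 n (s ++ t) = horner2 (horner2 n s) t.
Proof. exact: foldl_cat. Qed.

Lemma horner2_rev_bits n : horner2 0 (rev (bits n)) = n.
Proof.
have [m] := ubnP n; elim: m n => // m IH n hn.
rewrite bitsE; case: eqP => [->//|/eqP n0] /=.
rewrite rev_cons -cats1 horner2_cat IH; last by lia.
by rewrite /= odd_double_half.
Qed.

Lemma horner2_lt n s : horner2 n s < n.+1 * 2 ^ size s.
Proof.
elim: s n => [|b s IH] n /=; first by rewrite muln1.
rewrite expnS mulnA; apply: leq_trans (IH _) _.
by rewrite leq_mul2r; apply/orP; right; case: b; lia.
Qed.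

Lemma ltn_mul_exp a b c d : a < 2 ^ b -> c < 2 ^ d -> a * c < 2 ^ (b + d).
Proof.
move=> h1 h2; rewrite expnD; apply: ltn_mul => //.
Qed.

Lemma FP_horner2 (T : encType) (n : T -> nat) s :
  FP n -> FP s -> FP (fun t => horner2 (n t) (s t)).
Proof.
move=> hn hs; rewrite /horner2.
apply: (@FP_foldl T unit_encType nat_encType bool_encType (fun q => q.2 + q.1.2.*2)
  (fun n => 4 * n + 1) (fun=> tt)) => //.
- by apply: FP_bit_double; fp.
- by polyb.
- move=> c a s' /=; rewrite -/(horner2 a s').
  apply: leq_trans (esize_nat_le (b := esize a + size s') _) _.
    apply: leq_trans (horner2_lt _ _) _.
    by rewrite expnD leq_mul2r ltn_esize orbT.
  by have := size_esize (A := bool_encType) s'; lia.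
- by fp.
Qed.

End Naturals.

Section NaturalOps.
Local Open Scope nat_scope.

Lemma horner2E n s : horner2 n s = n * 2 ^ size s + horner2 0 s.
Proof.
elim: s n => [|b s IH] n; first by rewrite /= muln1 addn0.
rewrite /= -!/(horner2 _ _) (IH (b + n.*2)) (IH (b + 0.*2)) expnS; lia.
Qed.

Lemma esize_bool_le (b : bool) : esize b <= 3. Proof. by case: b. Qed.

Lemma esize_bits_le (s : seq bool) : esize s <= 4 * size s + 1.
Proof.
by elim: s => [|b s IH] //; rewrite esize_cons /=; have := esize_bool_le b; lia.
Qed.

(** Sum and carry of a full adder, spelled out as conditionals so that [fp] handles them. *)
Definition xor3 (a b c : bool) :=
  if a then (if b then c else if c then false else true)
  else (if b then (if c then false else true) else c).
Definition maj3 (a b c : bool) :=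
  if a then (if b then true else c) else (if b then c else false).

Definition add_step (q : nat * nat * bool * seq bool) :=
  (q.1.1.1./2, q.1.1.2./2, maj3 (odd q.1.1.1) (odd q.1.1.2) q.1.2,
   xor3 (odd q.1.1.1) (odd q.1.1.2) q.1.2 :: q.2).

(* The third component is now a borrow. *)
Definition sub_step (q : nat * nat * bool * seq bool) :=
  (q.1.1.1./2, q.1.1.2./2, maj3 (~~ odd q.1.1.1) (odd q.1.1.2) q.1.2,
   xor3 (odd q.1.1.1) (odd q.1.1.2) q.1.2 :: q.2).

(** Only the length matters: it is the number of rounds, enough for every digit of the sum. *)
Definition add_fuel (m n : nat) := bits m ++ bits n ++ [:: true].

Definition add_loop (m n : nat) :=
  foldl (fun q (_ : bool) => add_step q) (m, n, false, [::]) (add_fuel m n).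
Definition sub_loop (m n : nat) :=
  foldl (fun q (_ : bool) => sub_step q) (m, n, false, [::]) (add_fuel m n).

Lemma add_fuel_lt m n : m + n < 2 ^ size (add_fuel m n).
Proof.
rewrite !size_cat /= addn1 addnS expnS expnD.
have := ltn_bits m; have := ltn_bits n; move: (2 ^ _) (2 ^ _) => x y; nia.
Qed.

(** Digits are consed from the lowest one on, so the finished list has its highest digit first and
    [horner2] reads it without reversal. *)
Lemma add_foldl_spec (s : seq bool) a b c o :
  let q := foldl (fun q (_ : bool) => add_step q) (a, b, c, o) s in
  a + b + c < 2 ^ size s -> 
  horner2 0 q.2 = horner2 0 o + 2 ^ size o * (a + b + c).
Proof.
elim: s a b c o => [|x s IH] a b c o /=.
  by rewrite expn0 ltnS leqn0 => /eqP ->; rewrite muln0 addn0.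
have E : a + b + c = xor3 (odd a) (odd b) c + (a./2 + b./2 + maj3 (odd a) (odd b) c).*2.
  rewrite -{1}(odd_double_half a) -{1}(odd_double_half b).
  by rewrite /xor3 /maj3; case: (odd a); case: (odd b); case: c; lia.
rewrite expnS => h; rewrite IH; last by move: E h; rewrite /=; lia.
rewrite /= -/(horner2 _ _) horner2E expnS E; move: (xor3 _ _ _) (maj3 _ _ _) => u v.
move: (2 ^ _) => w; nia.
Qed.

(** Borrows are moved to the other side of the identity, which keeps it free of truncated
    subtraction and valid also when the difference is negative. *)
Lemma sub_foldl_spec (s : seq bool) a b c o :
  let q := foldl (fun q (_ : bool) => sub_step q) (a, b, c, o) s in
  [/\ a < 2 ^ size s -> q.1.1.1 = 0, b < 2 ^ size s -> q.1.1.2 = 0 &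
  horner2 0 q.2 + 2 ^ size q.2 * q.1.1.1 + 2 ^ size o * (b + c)
    = horner2 0 o + 2 ^ size o * a + 2 ^ size q.2 * (q.1.1.2 + q.1.2)].
Proof.
elim: s a b c o => [|x s IH] a b c o /=.
  by split; [case: a|case: b|].
have E : a + (maj3 (~~ odd a) (odd b) c + b./2).*2 = 
   xor3 (odd a) (odd b) c + (a./2).*2 + b + c.
  move: (odd_double_half a) (odd_double_half b).
  by rewrite /xor3 /maj3; case: (odd a); case: (odd b); case: c => /=; lia.
have /= [h1 h2 h3] := IH a./2 b./2 (maj3 (~~ odd a) (odd b) c)
  (xor3 (odd a) (odd b) c :: o).
rewrite expnS; split=> [h|h|]; [apply: h1; lia|apply: h2; lia|].
move: h3; rewrite -!/(horner2 _ _) (horner2E (_ + _)) expnS.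
set q := foldl _ _ s; move: (2 ^ size q.2 * _) (2 ^ size q.2 * _) (horner2 0 q.2) => A B V.
move: E; move: (xor3 _ _ _) (maj3 _ _ _) => u v.
move: (2 ^ _) (horner2 0 o) => w y; nia.
Qed.

Lemma add_loopE m n : horner2 0 (add_loop m n).2 = m + n.
Proof.
have := @add_foldl_spec (add_fuel m n) m n false [::].
by rewrite /= !addn0 expn0 add0n mul1n; apply; apply: add_fuel_lt.
Qed.

Lemma sub_loopE m n :
  (sub_loop m n).1.2 = (m < n) /\
  (n <= m -> horner2 0 (sub_loop m n).2 = m - n).
Proof.
have [/= h1 h2 h3] := @sub_foldl_spec (add_fuel m n) m n false [::].
have hf := add_fuel_lt m n.
move: h3; rewrite h1 ?h2; [|by lia|by lia].
rewrite /= muln0 !addn0 !mul1n !add0n -/(sub_loop m n).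
(* The output digits form a number below 2 to their length, so a final borrow occurs exactly when m
   < n. *)
have := horner2_lt 0 (sub_loop m n).2; rewrite mul1n.
case: (sub_loop m n).1.2; rewrite /= ?muln0 ?muln1; lia.
Qed.

End NaturalOps.

Ltac fp_bits :=
  lazymatch goal with
  | |- FP (fun x => half (@?f x)) => apply: (FP_half (n := f))
  | |- FP half => exact: (FP_half (FP_id _))
  | |- FP (fun x => odd (@?f x)) => apply: (FP_odd (n := f))
  | |- FP odd => exact: (FP_odd (FP_id _))
  | |- FP (fun x => bits (@?f x)) => apply: (FP_bits (n := f))
  | |- FP (fun x => cons (@?f x) (@?g x)) => apply: (FP_cons (x := f) (s := g))
  | |- FP (fun x => cat (@?f x) (@?g x)) => apply: (FP_cat (s1 := f) (s2 := g))
  | |- FP (fun x => zip (@?f x) (@?g x)) => apply: (FP_zip (s1 := f) (s2 := g))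
  | |- FP (fun x => rev (@?f x)) => apply: (FP_rev (s := f))
  | |- FP (fun x => map (@?h x) (@?s x)) => apply: (FP_map (h := h) (s := s))
  | |- FP (fun x => horner2 (@?f x) (@?g x)) =>
      apply: (FP_horner2 (n := f) (s := g))
  end.
Ltac fp_op ::= fp_bits.

Section NaturalFP.
Local Open Scope nat_scope.

Lemma FP_negb (T : encType) (b : T -> bool) : FP b -> FP (fun t => ~~ b t).
Proof.
move=> h; apply: (@FP_ext _ _ (fun t => if b t then false else true)); last by fp.
by move=> t; case: (b t).
Qed.

Lemma FP_andb (T : encType) (b c : T -> bool) : FP b -> FP c -> FP (fun t => b t && c t).
Proof.
move=> h1 h2; apply: (@FP_ext _ _ (fun t => if b t then c t else false)); last by fp.
by move=> t; case: (b t).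
Qed.

Lemma FP_addb (T : encType) (b c : T -> bool) : FP b -> FP c -> FP (fun t => b t (+) c t).
Proof.
move=> h1 h2; apply: (@FP_ext _ _ (fun t => if b t then ~~ c t else c t)).
  by move=> t; case: (b t).
by fp => //; exact: FP_negb.
Qed.

(** The two numbers never grow and the digit list gains at most one digit per round, which gives the
    size bound required for iteration. *)
Lemma bitloop_FP (T : encType) (step : nat * nat * bool * seq bool -> nat * nat * bool * seq bool)
    (a b : T -> nat) (s : T -> seq bool) :
  (forall q, [/\ (step q).1.1.1 <= q.1.1.1, (step q).1.1.2 <= q.1.1.2 &
                 size (step q).2 <= (size q.2).+1]) ->
  FP step -> FP a -> FP b -> FP s ->
  FP (fun t => foldl (fun q (_ : bool) => step q) (a t, b t, false, [::]) (s t)).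
Proof.
move=> hstep hs ha hb hf.
apply: (@FP_foldl T unit_encType _ _ (fun q => step q.1.2)
  (fun n => 12 * n + 10) (fun=> tt)); rewrite /=; last 2 first.
- by fp.
- by [].
- by apply: (FP_comp (f := fun q : unit * _ * bool => q.1.2) _ hs); fp.
- by polyb.
- move=> c q s' /=.
  set r := foldl _ q s'.
  have [h1 h2 h3] : [/\ r.1.1.1 <= q.1.1.1, r.1.1.2 <= q.1.1.2 &
    size r.2 <= size q.2 + size s'].
    rewrite /r {r}; elim: s' q => [|x s' IH] q /=; first by rewrite addn0.
    by have [? ? ?] := IH (step q); have [? ? ?] := hstep q; split; lia.
  case: r h1 h2 h3 => [[[x y] z] w]; case: q => [[[x' y'] z'] w'] /= h1 h2 h3.
  rewrite !esize_pair.
  have := esize_nat_mono h1; have := esize_nat_mono h2.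
  have := esize_bool_le z; have := esize_bits_le w.
  have := size_esize_bits w'.
  have := size_esize_bits s'. lia.
- by fp.
Qed.

Lemma FP_add_loop (T : encType) (a b : T -> nat) :
  FP a -> FP b -> FP (fun t => add_loop (a t) (b t)).
Proof.
move=> ha hb; apply: bitloop_FP => //; last by rewrite /add_fuel; fp.
  by move=> q; rewrite /add_step /=; split; lia.
by rewrite /add_step /xor3 /maj3; fp.
Qed.

Lemma FP_sub_loop (T : encType) (a b : T -> nat) :
  FP a -> FP b -> FP (fun t => sub_loop (a t) (b t)).
Proof.
move=> ha hb; apply: bitloop_FP => //; last by rewrite /add_fuel; fp.
  by move=> q; rewrite /sub_step /=; split; lia.
by rewrite /sub_step /xor3 /maj3; fp; apply: FP_negb; fp.
Qed.

Lemma FP_addn (T : encType) (a b : T -> nat) :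
  FP a -> FP b -> FP (fun t => a t + b t).
Proof.
move=> ha hb; apply: (@FP_ext _ _ (fun t => horner2 0 (add_loop (a t) (b t)).2)).
  by move=> t; exact: add_loopE.
by fp; apply: FP_add_loop.
Qed.

Lemma FP_ltn (T : encType) (a b : T -> nat) :
  FP a -> FP b -> FP (fun t => a t < b t).
Proof.
move=> ha hb; apply: (@FP_ext _ _ (fun t => (sub_loop (a t) (b t)).1.2)).
  by move=> t; case: (sub_loopE (a t) (b t)).
by fp; apply: FP_sub_loop.
Qed.

Lemma FP_subn (T : encType) (a b : T -> nat) :
  FP a -> FP b -> FP (fun t => a t - b t).
Proof.
move=> ha hb; apply: (@FP_ext _ _ (fun t => if a t < b t then 0 else
    horner2 0 (sub_loop (a t) (b t)).2)).
  move=> t; have [_ h] := sub_loopE (a t) (b t).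
  by case: ltnP => ab; [lia|exact: h].
by fp; [apply: FP_ltn|apply: FP_sub_loop].
Qed.

Lemma FP_leq (T : encType) (a b : T -> nat) :
  FP a -> FP b -> FP (fun t => a t <= b t).
Proof.
move=> ha hb; apply: (@FP_ext _ _ (fun t => ~~ (b t < a t))).
  by move=> t; rewrite -leqNgt.
by apply: FP_negb; apply: FP_ltn.
Qed.

(** Shift and add along the digits of the first factor. Doubling is written [false + acc.*2] so that
    [FP_bit_double] applies. *)
Lemma FP_muln (T : encType) (a b : T -> nat) :
  FP a -> FP b -> FP (fun t => a t * b t).
Proof.
move=> ha hb.
have E n m s : foldl (fun acc (d : bool) => (if d then m else 0) + (false + acc.*2)) (n * m) s
    = horner2 n s * m.
  elim: s n => [|d s IH] n //=; rewrite -(IH (d + n.*2)); congr foldl.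
  by case: d => /=; lia.
apply: (@FP_ext _ _ (fun t => foldl (fun acc (d : bool) => (if d then b t else 0) + (false + acc.*2))
    0 (rev (bits (a t))))).
  by move=> t; rewrite -[0 in LHS](mul0n (b t)) E horner2_rev_bits.
apply: (@FP_foldl T nat_encType _ _
  (fun q : nat * nat * bool => (if q.2 then q.1.1 else 0) + (false + q.1.2.*2))
  (fun n => 4 * n + 1)) => //.
- apply: FP_addn; first by fp.
  by apply: FP_bit_double; fp.
- by polyb.
- move=> m n s /=; set r := foldl _ _ _.
  apply: leq_trans (esize_nat_le (b := esize m + esize n + size s) _) _.
    have : r < (n + m).+1 * 2 ^ size s.
      rewrite /r {r}; elim: s n => [|d s IH] n /=; first by rewrite muln1; lia.
      apply: leq_trans (IH _) _; rewrite expnS mulnA leq_mul2r; apply/orP; right.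
      by case: d => /=; lia.
    move=> h; apply: leq_trans h _; rewrite expnD leq_mul2r; apply/orP; right.
    have := ltn_esize m; have := ltn_esize n; rewrite expnD.
    move: (2 ^ _) (2 ^ _) => x y; nia.
  by have := size_esize (A := bool_encType) s; lia.
- by fp.
- by fp.
Qed.

End NaturalFP.

Ltac fp_nat :=
  lazymatch goal with
  | |- FP (fun x => addn (@?f x) (@?g x)) => apply: (FP_addn (a := f) (b := g))
  | |- FP (fun x => subn (@?f x) (@?g x)) => apply: (FP_subn (a := f) (b := g))
  | |- FP (fun x => muln (@?f x) (@?g x)) => apply: (FP_muln (a := f) (b := g))
  | |- FP (fun x => leq (S (@?f x)) (@?g x)) => apply: (FP_ltn (a := f) (b := g))
  | |- FP (fun x => leq (@?f x) (@?g x)) => apply: (FP_leq (a := f) (b := g))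
  | |- FP (fun x => eq_op (@?f x) 0%N) => apply: (FP_eq0 (n := f))
  | |- FP (fun x => negb (@?f x)) => apply: (FP_negb (b := f))
  | |- FP (fun x => andb (@?f x) (@?g x)) => apply: (FP_andb (b := f) (c := g))
  end.
Ltac fp_op ::= first [fp_bits | fp_nat].

(** * Division with remainder and greatest common divisors *)

Section Division.
Local Open Scope nat_scope.

(* A step of long division, fed with the digits of the dividend from the highest one. *)
Definition div_step (b : nat) (q : nat * nat) (x : bool) : nat * nat :=
  if b <= x + q.2.*2 then (true + q.1.*2, (x + q.2.*2) - b)
  else (false + q.1.*2, x + q.2.*2).

Lemma div_stepE b q r x : div_step b (q, r) x =
  if b <= x + r.*2 then (true + q.*2, x + r.*2 - b) else (false + q.*2, x + r.*2).
Proof. by []. Qed.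

Definition div_loop (b a : nat) := foldl (div_step b) (0, 0) (rev (bits a)).

Lemma div_foldl_spec b s q r : 0 < b -> r < b ->
  let p := foldl (div_step b) (q, r) s in
  p.1 * b + p.2 = horner2 (q * b + r) s /\ p.2 < b.
Proof.
move=> b0; elim: s q r => //= x s IH q r rb.
rewrite div_stepE; case: (leqP b (x + r.*2)) => h.
- have [|-> ->] := IH (true + q.*2) (x + r.*2 - b); first by case: x h => /=; lia.
  split=> //; congr horner2; lia.
- have [|-> ->] := IH (false + q.*2) (x + r.*2); first by [].
  split=> //; congr horner2; lia.
Qed.

Lemma div_loopE a b : 0 < b -> div_loop b a = (a %/ b, a %% b).
Proof.
move=> b0; have [] := @div_foldl_spec b (rev (bits a)) 0 0 b0 b0.
rewrite -/(div_loop b a) mul0n horner2_rev_bits; case: (div_loop b a) => q r /= <- h.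
by rewrite divnMDl // modnMDl divn_small // modn_small // addn0.
Qed.

(** The growth condition of [FP_foldl] ranges over all arguments, including divisor 0 and unreduced
    remainders, so the bound may not rely on r < b. *)
Lemma div_foldl_le b s q r (p := foldl (div_step b) (q, r) s) :
  p.1 < q.+1 * 2 ^ size s /\ p.2 < r.+1 * 2 ^ size s.
Proof.
rewrite {}/p; elim: s q r => [|x s IH] q r /=; first by rewrite !muln1.
rewrite expnS !mulnA div_stepE; have hx : x <= 1 by case: x.
have le m n k : m <= n -> m * k <= n * k by move=> h; rewrite leq_mul2r h orbT.
by case: ifP => h; [have [h1 h2] := IH (true + q.*2) (x + r.*2 - b)
   | have [h1 h2] := IH (false + q.*2) (x + r.*2)]; split;
  (apply: leq_trans; [eassumption|]); apply: le; rewrite /=; lia.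
Qed.

Lemma FP_div_loop (T : encType) (a b : T -> nat) :
  FP a -> FP b -> FP (fun t => div_loop (b t) (a t)).
Proof.
move=> ha hb.
apply: (@FP_foldl T nat_encType (prod_encType nat_encType nat_encType) bool_encType
  (fun q => div_step q.1.1 q.1.2 q.2) (fun n => 8 * n + 10)) => //; [ |by polyb| |by fp|by fp].
- rewrite /div_step.
  have h : FP (fun x : nat * (nat * nat) * bool => x.2 + x.1.2.2.*2).
    by apply: FP_bit_double; fp.
  apply: FP_if; first by apply: FP_leq; [fp|exact: h].
    by apply: FP_pair; [apply: FP_bit_double; fp|apply: FP_subn; [exact: h|fp]].
  by apply: FP_pair; [apply: FP_bit_double; fp|exact: h].
- move=> b0 [q r] s /=; have := div_foldl_le b0 s q r.
  case: (foldl _ _ s) => q' r' /= [h1 h2].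
  have l x y : x < y.+1 * 2 ^ size s -> esize x <= 4 * (esize y + size s) + 1.
    move=> h; apply: esize_nat_le; apply: leq_trans h _.
    by rewrite expnD leq_mul2r ltn_esize orbT.
  rewrite !esize_pair; have := l _ _ h1; have := l _ _ h2.
  have := size_esize (A := bool_encType) s; move: h1 h2 => _ _; lia.
Qed.

Lemma FP_modn (T : encType) (a b : T -> nat) :
  FP a -> FP b -> FP (fun t => a t %% b t).
Proof.
move=> ha hb; apply: (@FP_ext _ _ (fun t => if b t == 0 then a t else (div_loop (b t) (a t)).2)).
  by move=> t; case: eqP => [->|/eqP]; rewrite ?modn0 // -lt0n => /(div_loopE (a t)) ->.
by fp => //; apply: FP_div_loop.
Qed.

Lemma FP_divn (T : encType) (a b : T -> nat) :
  FP a -> FP b -> FP (fun t => a t %/ b t).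
Proof.
move=> ha hb; apply: (@FP_ext _ _ (fun t => if b t == 0 then 0 else (div_loop (b t) (a t)).1)).
  by move=> t; case: eqP => [->|/eqP]; rewrite ?divn0 // -lt0n => /(div_loopE (a t)) ->.
by fp => //; apply: FP_div_loop.
Qed.

Definition gcd_step (q : nat * nat) := if q.2 == 0 then q else (q.2, q.1 %% q.2).

Definition gcd_fuel (b : nat) := bits b ++ bits b ++ [:: true].

Definition gcd_loop (a b : nat) :=
  foldl (fun q (_ : bool) => gcd_step q) (a, b) (gcd_fuel b).

Lemma gcd_step_gcdn q : gcdn (gcd_step q).1 (gcd_step q).2 = gcdn q.1 q.2.
Proof.
rewrite /gcd_step; case: ifP => //= _.
by rewrite gcdn_modr gcdnC.
Qed.

(** With r the remainder of a by b, b >= r + (b mod r) > 2 (b mod r). Two rounds thus halve the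
    second component, and the number of rounds is linear in its number of digits. *)
Lemma gcd_step2_le a b : (gcd_step (gcd_step (a, b))).2.*2 <= b.
Proof.
have E x y : gcd_step (x, y) = if y == 0 then (x, y) else (y, x %% y) by [].
rewrite E; case: (eqVneq b 0) => [->|b0]; first by rewrite E.
rewrite E; case: (eqVneq (a %% b) 0) => [->//|r0] /=.
have rb : a %% b < b by rewrite ltn_mod lt0n.
have h1 : b %% (a %% b) < a %% b by rewrite ltn_mod lt0n.
have h3 : 0 < b %/ (a %% b) by rewrite divn_gt0 ?lt0n // ltnW.
have h2 := divn_eq b (a %% b).
move: (a %% b) h1 h2 h3 => r; move: (b %/ r) (b %% r) => q t; nia.
Qed.

Lemma gcd_foldl (s : seq bool) a b : b < 2 ^ (size s)./2 -> odd (size s) ->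
  (foldl (fun q (_ : bool) => gcd_step q) (a, b) s).2 = 0.
Proof.
have [m] := ubnP (size s); elim: m s a b => // m IH [|x [|y s]] a b //= hm hb.
  have -> : b = 0 by lia.
  by rewrite /gcd_step.
rewrite negbK => od.
rewrite [X in foldl _ X _](_ : _ = ((gcd_step (gcd_step (a, b))).1, (gcd_step (gcd_step (a, b))).2)); last by case: (gcd_step (gcd_step (a, b))).
apply: IH => //; first by lia.
by have := gcd_step2_le a b; rewrite expnS in hb; lia.
Qed.

Lemma gcd_loopE a b : (gcd_loop a b).1 = gcdn a b.
Proof.
have h0 : (gcd_loop a b).2 = 0.
  apply: gcd_foldl; rewrite /gcd_fuel !size_cat /= addn1 addnS addnn /=.
    by rewrite uphalf_double ltn_bits.
  by rewrite odd_double.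
have : gcdn (gcd_loop a b).1 (gcd_loop a b).2 = gcdn a b.
  rewrite /gcd_loop -[RHS]/(gcdn (a, b).1 (a, b).2).
  elim: (gcd_fuel b) (a, b) => //= x s IH q.
  by rewrite IH gcd_step_gcdn.
by rewrite h0 gcdn0.
Qed.

Lemma FP_gcdn (T : encType) (a b : T -> nat) :
  FP a -> FP b -> FP (fun t => gcdn (a t) (b t)).
Proof.
move=> ha hb; apply: (@FP_ext _ _ (fun t => (gcd_loop (a t) (b t)).1)).
  by move=> t; apply: gcd_loopE.
apply: FP_fst; rewrite /gcd_loop.
apply: (@FP_foldl T unit_encType (prod_encType nat_encType nat_encType) bool_encType
  (fun q => gcd_step q.1.2) (fun n => 12 * n + 10) (fun=> tt)) => //; [ |by polyb| |by fp|by fp|].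
- by rewrite /gcd_step; fp; apply: FP_modn; fp.
- move=> c [x y] s /=; set r := foldl _ _ s.
  have [h1 h2] : r.1 <= x + y /\ r.2 <= x + y.
    have [// h1 h2] : (r.1 <= maxn x y) /\ (r.2 <= maxn x y).
      rewrite /r {r}; elim: s x y => [|d s IH] x y /=; first by split; lia.
      have [] := IH (gcd_step (x, y)).1 (gcd_step (x, y)).2.
      rewrite -surjective_pairing => h1 h2.
      have h : maxn (gcd_step (x, y)).1 (gcd_step (x, y)).2 <= maxn x y.
        rewrite /gcd_step; case: eqP => //= /eqP y0.
        have : x %% y < y by rewrite ltn_mod lt0n.
        by lia.
      by split; apply: leq_trans h.
    by split; lia.
  have l z : z <= x + y -> esize z <= 4 * (esize x + esize y) + 1.
    move=> h; apply: esize_nat_le; apply: leq_ltn_trans h _.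
    have := ltn_esize x; have := ltn_esize y; rewrite expnD.
    move: (2 ^ _) (2 ^ _) => u v; nia.
  case: r h1 h2 => u v /= /l h1 /l h2; rewrite !esize_pair; lia.
- by rewrite /gcd_fuel; fp.
Qed.

End Division.

(** * Integers and fractions in lowest terms *)

Section IntegersRationals.

Lemma FP_ltz0 (T : encType) (z : T -> int) : FP z -> FP (fun t => z t < 0).
Proof.
move=> hz; apply: (FP_comp (g := fun z : int => z < 0) hz).
have h : FP (fun z : int => (z < 0, `|z|%N)) by exact: FP_recode.
exact: (FP_fst h).
Qed.

Lemma FP_absz (T : encType) (z : T -> int) : FP z -> FP (fun t => `|z t|%N).
Proof.
move=> hz; apply: (FP_comp (g := fun z : int => `|z|%N) hz).
have h : FP (fun z : int => (z < 0, `|z|%N)) by exact: FP_recode.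
exact: (FP_snd h).
Qed.

Definition signed_int (b : bool) (n : nat) : int := if b then - n%:Z else n%:Z.

Lemma FP_signed_int (T : encType) (b : T -> bool) (n : T -> nat) :
  FP b -> FP n -> FP (fun t => signed_int (b t) (n t)).
Proof.
move=> hb hn; apply: (FP_enc_eq (g := fun t => (b t && (0 < n t)%N, n t))).
  move=> t; rewrite /signed_int enc_pair; move: (b t) (n t) => c m.
  rewrite {1}/enc /= /enc_int.
  suff -> : ((if c then - m%:Z else m%:Z) < 0) = c && (0 < m)%N.
    by case: c => //; rewrite abszN.
  by case: c; case: m.
apply: FP_pair => //; apply: FP_andb => //; apply: FP_ltn => //; exact: FP_const.
Qed.

Lemma FP_Posz (T : encType) (n : T -> nat) : FP n -> FP (fun t => (n t)%:Z).
Proof. by move=> hn; apply: (@FP_signed_int T (fun=> false)) => //; exact: FP_const. Qed.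

Lemma FP_oppz (T : encType) (z : T -> int) : FP z -> FP (fun t => - z t).
Proof.
move=> hz; apply: (@FP_ext _ _ (fun t => signed_int (~~ (z t < 0)) `|z t|%N)).
  by move=> t; rewrite /signed_int; case: ltP => h /=; lia.
apply: FP_signed_int; last exact: FP_absz.
by apply: FP_negb; apply: FP_ltz0.
Qed.

Lemma FP_eqz0 (T : encType) (z : T -> int) : FP z -> FP (fun t => z t == 0).
Proof.
move=> hz; apply: (@FP_ext _ _ (fun t => `|z t|%N == 0%N)).
  by move=> t; rewrite absz_eq0.
by apply: FP_eq0; apply: FP_absz.
Qed.

Lemma FP_mulz (T : encType) (y z : T -> int) :
  FP y -> FP z -> FP (fun t => y t * z t).
Proof.
move=> hy hz; apply: (@FP_ext _ _
  (fun t => signed_int ((y t < 0) (+) (z t < 0)) (`|y t| * `|z t|)%N)).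
  move=> t; rewrite /signed_int PoszM !abszE.
  case: (ltP (y t)) => h1; [rewrite (ltr0_norm h1)|rewrite (ger0_norm h1)];
  (case: (ltP (z t)) => h2; [rewrite (ltr0_norm h2)|rewrite (ger0_norm h2)]);
  rewrite /=; ring.
apply: FP_signed_int; first by apply: FP_addb; apply: FP_ltz0.
by apply: FP_muln; apply: FP_absz.
Qed.

Lemma FP_subz_nat (T : encType) (m n : T -> nat) :
  FP m -> FP n -> FP (fun t => (m t)%:Z - (n t)%:Z).
Proof.
move=> hm hn; apply: (@FP_ext _ _ (fun t =>
  signed_int (m t < n t)%N (if (m t < n t)%N then n t - m t else m t - n t)%N)).
  by move=> t; rewrite /signed_int; case: ltnP => h; lia.
apply: FP_signed_int; first exact: FP_ltn.
by apply: FP_if; [exact: FP_ltn|exact: FP_subn|exact: FP_subn].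
Qed.

(** Splitting both integers into positive and negative parts leaves two sums of natural numbers and
    one signed difference. *)
Lemma FP_addz (T : encType) (y z : T -> int) :
  FP y -> FP z -> FP (fun t => y t + z t).
Proof.
move=> hy hz.
pose p (z : int) := if z < 0 then 0%N else `|z|%N.
pose n (z : int) := if z < 0 then `|z|%N else 0%N.
have hp (u : T -> int) : FP u -> FP (fun t => p (u t)).
  by move=> hu; apply: FP_if; [exact: FP_ltz0|exact: FP_const|exact: FP_absz].
have hn (u : T -> int) : FP u -> FP (fun t => n (u t)).
  by move=> hu; apply: FP_if; [exact: FP_ltz0|exact: FP_absz|exact: FP_const].
apply: (@FP_ext _ _ (fun t => (p (y t) + p (z t))%N%:Z - (n (y t) + n (z t))%N%:Z)).
  by move=> t; rewrite /p /n; case: ltP => h1; case: ltP => h2; lia.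
by apply: FP_subz_nat; apply: FP_addn; auto.
Qed.

Lemma FP_numq (T : encType) (q : T -> rat) : FP q -> FP (fun t => numq (q t)).
Proof.
move=> hq; apply: (FP_comp (g := fun q : rat => numq q) hq).
have h : FP (fun q : rat => (numq q, `|denq q|%N)) by exact: FP_recode.
exact: (FP_fst h).
Qed.

Lemma FP_denq (T : encType) (q : T -> rat) : FP q -> FP (fun t => `|denq (q t)|%N).
Proof.
move=> hq; apply: (FP_comp (g := fun q : rat => `|denq q|%N) hq).
have h : FP (fun q : rat => (numq q, `|denq q|%N)) by exact: FP_recode.
exact: (FP_snd h).
Qed.

Lemma FP_divz (T : encType) (m n : T -> int) :
  FP m -> FP n -> FP (fun t => (m t)%:Q / (n t)%:Q).
Proof.
move=> hm hn.
pose g t := gcdn `|m t| `|n t|.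
have hg : FP g by apply: FP_gcdn; apply: FP_absz.
(* Division by 0 yields 0, whose lowest terms are 0 / 1. *)
apply: (FP_enc_eq (g := fun t => if n t == 0 then (0%:Z, 1%N) else
  (signed_int ((n t < 0) (+) (m t < 0)) (`|m t| %/ g t)%N, (`|n t| %/ g t)%N))).
  move=> t; rewrite -[_ / _](fracqE (m t, n t)).
  rewrite -[LHS]/(enc (numq (fracq (m t, n t)), `|denq (fracq (m t, n t))|%N)).
  congr enc; rewrite num_fracq den_fracq /=; case: eqP => //= _; congr pair.
  by rewrite /signed_int /g; case: addb; rewrite ?expr1z ?expr0z ?mulN1r ?mul1r.
apply: FP_if; [exact: FP_eqz0|exact: FP_const|].
apply: FP_pair; last by apply: FP_divn => //; apply: FP_absz.
apply: FP_signed_int; first by apply: FP_addb; apply: FP_ltz0.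
by apply: FP_divn => //; apply: FP_absz.
Qed.

End IntegersRationals.

Ltac fp_int :=
  lazymatch goal with
  | |- FP (fun x => divn (@?f x) (@?g x)) => apply: (FP_divn (a := f) (b := g))
  | |- FP (fun x => eq_op (@?f x) 0) => apply: (FP_eqz0 (z := f))
  | |- FP (fun x => (@?f x) * (@?g x)) => apply: (FP_mulz (y := f) (z := g))
  | |- FP (fun x => (@?f x) + (@?g x)) => apply: (FP_addz (y := f) (z := g))
  | |- FP (fun x => - (@?f x)) => apply: (FP_oppz (z := f))
  | |- FP (fun x => Posz (@?f x)) => apply: (FP_Posz (n := f))
  | |- FP Posz => exact: (FP_Posz (FP_id _))
  | |- FP (fun x => numq (@?f x)) => apply: (FP_numq (q := f))
  | |- FP (fun x => `|denq (@?f x)|%N) => apply: (FP_denq (q := f))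
  end.
Ltac fp_op ::= first [fp_bits | fp_nat | fp_int].

(** * The algorithm *)

Section IntegerVectors.

Definition sumz (s : seq int) := foldl (fun a x => a + x) 0 s.
Definition dot (u v : seq int) := sumz [seq p.1 * p.2 | p <- zip u v].
Definition mulv (A : seq (seq int)) (v : seq int) := [seq dot r v | r <- A].
Definition lincomb (a b : int) (x y : seq int) :=
  [seq a * p.1 + b * p.2 | p <- zip x y].

Lemma esize_int_le (z : int) b : (`|z| < 2 ^ b -> esize z <= 4 * b + 5)%N.
Proof.
move=> h; have -> : esize z = esize (z < 0, `|z|%N) by [].
by rewrite esize_pair; have := esize_nat_le h; have := esize_bool_le (z < 0); lia.
Qed.

Lemma ltn_esize_int (z : int) : (`|z| < 2 ^ esize z)%N.
Proof.
have -> : esize z = esize (z < 0, `|z|%N) by [].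
apply: leq_trans (ltn_esize `|z|) _; rewrite leq_pexp2l // esize_pair; lia.
Qed.

Lemma exp2_leD a b k m : (a < 2 ^ k -> b < 2 ^ m -> a + b < 2 ^ (k + m).+1)%N.
Proof.
rewrite expnS expnD; move: (expn_gt0 2 k) (expn_gt0 2 m) => /=.
move: (2 ^ k)%N (2 ^ m)%N => u v; nia.
Qed.

Lemma leq_exp2_trans x a b : (x < 2 ^ a -> a <= b -> x < 2 ^ b)%N.
Proof. by move=> h ab; apply: leq_trans h _; rewrite leq_pexp2l. Qed.

Lemma FP_sumz (T : encType) (s : T -> seq int) : FP s -> FP (fun t => sumz (s t)).
Proof.
move=> hs; rewrite /sumz.
apply: (@FP_foldl T unit_encType int_encType int_encType (fun q => q.1.2 + q.2)
  (fun n => 4 * n + 5)%N (fun=> tt)) => //; [by fp|by polyb| |by fp|by fp].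
move=> c a s' /=.
apply: leq_trans (esize_int_le (b := esize a + esize s') _) _; last by lia.
have := ltn_esize_int a; move: (esize a) => k.
elim: s' a k => [|x s' IH] a k /= h; first by apply: leq_exp2_trans h _; lia.
rewrite esize_cons addnS -addSn addnA; apply: IH.
by apply: leq_ltn_trans (exp2_leD h (ltn_esize_int x)); lia.
Qed.

Lemma FP_dot (T : encType) (u v : T -> seq int) :
  FP u -> FP v -> FP (fun t => dot (u t) (v t)).
Proof. by move=> hu hv; rewrite /dot; apply: FP_sumz; fp. Qed.

Lemma FP_mulv (T : encType) (A : T -> seq (seq int)) (v : T -> seq int) :
  FP A -> FP v -> FP (fun t => mulv (A t) (v t)).
Proof.
move=> hA hv; rewrite /mulv; fp => //; apply: FP_dot; fp.
by apply: (FP_comp (f := fst) _ hv); fp.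
Qed.

Lemma FP_lincomb (T : encType) (a b : T -> int) (x y : T -> seq int) :
  FP a -> FP b -> FP x -> FP y -> FP (fun t => lincomb (a t) (b t) (x t) (y t)).
Proof.
move=> ha hb hx hy; rewrite /lincomb; fp => //.
  by apply: (FP_comp (f := fst) _ ha); fp.
by apply: (FP_comp (f := fst) _ hb); fp.
Qed.

(** Growth is measured in bits of the entries, since each operation adds a known amount to [b]; tree
    sizes are derived only at the end of a loop. *)
Definition vle (b : nat) (v : seq int) := all (fun z => `|z| < 2 ^ b)%N v.

Lemma vle_mono a b v : (a <= b)%N -> vle a v -> vle b v.
Proof.
by move=> ab; apply: sub_all => z h; apply: leq_exp2_trans h ab.
Qed.

Lemma vle_esize v : vle (esize v) v.
Proof.
elim: v => //= x v IH; rewrite esize_cons; apply/andP; split.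
  by apply: leq_exp2_trans (ltn_esize_int x) _; lia.
by apply: vle_mono IH; lia.
Qed.

Lemma esize_vle b v : vle b v -> (esize v <= 1 + size v * (4 * b + 6))%N.
Proof.
elim: v => //= x v IH /andP[/esize_int_le hx /IH hv]; rewrite esize_cons; lia.
Qed.

Lemma sumz_lt a c s : vle a s -> (size s <= c)%N -> (`|sumz s| < 2 ^ (a + c))%N.
Proof.
move=> h hc; have h0 : (`|sumz s| <= size s * 2 ^ a)%N.
  have gen (z : int) : (`|foldl (fun a x => (a + x)%R) z s| <= `|z| + size s * 2 ^ a)%N.
    elim: s h z {hc} => [|x s IH] /=; first by move=> _ z; lia.
    by move=> /andP[hx hs] z; apply: leq_trans (IH hs _) _; lia.
  by have := gen 0; rewrite add0n.
apply: leq_ltn_trans h0 _; rewrite expnD mulnC ltn_pmul2l ?expn_gt0 //.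
by apply: leq_ltn_trans hc _; apply: ltn_expl.
Qed.

Lemma dot_lt a b c u v : vle a u -> vle b v -> (size u <= c)%N ->
  (`|dot u v| < 2 ^ (a + b + c))%N.
Proof.
move=> hu hv hc; apply: sumz_lt; last by rewrite size_map size_zip; apply: leq_trans (geq_minl _ _) hc.
elim: u v hu hv {hc} => [|x u IH] [|y v] //= /andP[hx hu] /andP[hy hv].
by rewrite IH // andbT abszM ltn_mul_exp.
Qed.

(** The number of added bits depends on the matrix and not on [b], so l applications add 2 a l bits,
    a polynomial amount once l is counted in unary. *)
Lemma mulv_lt a b A v : all (fun r => vle a r && (size r <= a)%N) A -> vle b v ->
  vle (b + 2 * a) (mulv A v).
Proof.
move=> hA hv; rewrite /vle all_map; apply: sub_all hA => r /andP[hr sr] /=.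
by apply: leq_exp2_trans (dot_lt hr hv sr) _; lia.
Qed.

Lemma rows_esize (A : seq (seq int)) a : (esize A <= a)%N ->
  all (fun r => vle a r && (size r <= a)%N) A.
Proof.
elim: A => //= r A IH; rewrite esize_cons => h; rewrite IH; last by lia.
rewrite (vle_mono _ (vle_esize r)) /=; last by lia.
by have := size_esize (A := int_encType) r; rewrite /=; lia.
Qed.

Lemma lincomb_lt k t p q a b m x y : (`|k| < 2 ^ p)%N -> (`|t| < 2 ^ q)%N ->
  vle a x -> vle b y -> (p + a <= m)%N -> (q + b <= m)%N ->
  vle m.+1 (lincomb k t x y).
Proof.
move=> hk ht; elim: x y => [|u x IH] [|v y] //= /andP[hu hx] /andP[hv hy] h1 h2.
rewrite [vle _ _]/= IH // andbT expnS mul2n -addnn.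
apply: (@leq_ltn_trans (`|(k * u)%R| + `|(t * v)%R|)%N); first by rewrite /=; lia.
rewrite !abszM -addSn; apply: leq_add; last apply: ltnW.
  by apply: leq_exp2_trans (ltn_mul_exp hk hu) h1.
by apply: leq_exp2_trans (ltn_mul_exp ht hv) h2.
Qed.

End IntegerVectors.

(** * Bit growth in the Faddeev-LeVerrier recursion *)

Section Loops.

Notation vecE := (seq_encType int_encType).
Notation matE := (seq_encType vecE).
Notation unaryE := (seq_encType unit_encType).

(** The exponent is the length of [u]: counting in unary is what makes this polynomial-time. *)
Definition powv (u : seq unit) (A : seq (seq int)) (v : seq int) :=
  foldl (fun v (_ : unit) => mulv A v) v u.

Lemma size_mulv A v : size (mulv A v) = size A. Proof. exact: size_map. Qed.

Lemma size_powv u A v : (size (powv u A v) <= size A + size v)%N.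
Proof.
case: u => [|x u]; first by rewrite leq_addl.
suff -> : size (powv (x :: u) A v) = size A by rewrite leq_addr.
rewrite /powv; elim: u x v => [|y u IH] x v; first by rewrite /= size_mulv.
exact: (IH y (mulv A v)).
Qed.

Lemma powv_lt a b u A v : all (fun r => vle a r && (size r <= a)%N) A -> vle b v ->
  vle (b + 2 * a * size u) (powv u A v).
Proof.
move=> hA; rewrite /powv; elim: u b v => [|x u IH] b v hv /=.
  by rewrite muln0 addn0.
by apply: vle_mono (IH _ _ (mulv_lt hA hv)); lia.
Qed.

Lemma FP_powv (T : encType) (u : T -> seq unit) (A : T -> seq (seq int)) (v : T -> seq int) :
  FP u -> FP A -> FP v -> FP (fun t => powv (u t) (A t) (v t)).
Proof.
move=> hu hA hv; rewrite /powv.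
apply: (@FP_foldl T matE vecE unit_encType (fun q => mulv q.1.1 q.1.2)
  (fun n => 1 + n * (4 * (n + 2 * n * n) + 6))%N A) => //; [|by polyb|].
  by apply: FP_mulv; fp.
move=> A0 v0 u0 /=; rewrite -/(powv _ _ _); set n := (esize A0 + esize v0 + esize u0)%N.
have hA0 : (esize A0 <= n)%N by rewrite /n; lia.
have hb : vle (n + 2 * n * size u0) (powv u0 A0 v0).
  apply: powv_lt; first exact: rows_esize.
  by apply: vle_mono (vle_esize v0); rewrite /n; lia.
have hu0 : (size u0 <= n)%N.
  by have := @size_esize unit_encType u0; rewrite /n /=; lia.
have hs : (size (powv u0 A0 v0) <= n)%N.
  apply: leq_trans (size_powv _ _ _) _.
  have := @size_esize vecE A0; have := @size_esize int_encType v0.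
  by rewrite /n /=; lia.
apply: leq_trans (esize_vle hb) _; rewrite leq_add2l leq_mul //.
by rewrite leq_add2r leq_mul2l /= leq_add2l leq_mul2l hu0 orbT.
Qed.

(* The action of [A ^ l - D ^ l] on vectors, for [u] of size [l] and [Dl = D ^ l]. *)
Definition shiftv (u : seq unit) A (Dl : int) v := lincomb 1 (- Dl) (powv u A v) v.

Lemma FP_shiftv (T : encType) (u : T -> seq unit) (A : T -> seq (seq int))
    (Dl : T -> int) (v : T -> seq int) :
  FP u -> FP A -> FP Dl -> FP v -> FP (fun t => shiftv (u t) (A t) (Dl t) (v t)).
Proof.
move=> hu hA hD hv; apply: FP_lincomb => //; first exact: FP_const.
  exact: FP_oppz.
exact: FP_powv.
Qed.

Lemma size_lincomb a b x y : (size (lincomb a b x y) <= size y)%N.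
Proof. by rewrite size_map size_zip geq_minr. Qed.

Lemma shiftv_lt a b w m u A Dl v : all (fun r => vle a r && (size r <= a)%N) A ->
  vle b v -> (`|Dl| < 2 ^ w)%N -> (b + 2 * a * size u + w < m)%N ->
  vle m.+1 (shiftv u A Dl v).
Proof.
move=> hA hv hD hm.
apply: (@lincomb_lt _ _ 1 w _ _ m _ _ _ _ (powv_lt u hA hv) hv) => //.
- by rewrite abszN.
- by lia.
- by apply: leq_trans (ltnW hm); rewrite addnC leq_add2r leq_addr.
Qed.

(** A trace when [J] lists the columns of the identity and [M] those of a matrix; pairing the two
    lists avoids access by index. *)
Definition trz (J M : seq (seq int)) := sumz [seq dot p.1 p.2 | p <- zip J M].

Lemma FP_trz (T : encType) (J M : T -> seq (seq int)) :
  FP J -> FP M -> FP (fun t => trz (J t) (M t)).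
Proof. by move=> hI hM; apply: FP_sumz; fp => //; apply: FP_dot; fp. Qed.

Lemma trz_lt a b J M : all (fun r => vle a r && (size r <= a)%N) J -> (size J <= a)%N ->
  all (vle b) M -> (`|trz J M| < 2 ^ (b + 3 * a))%N.
Proof.
move=> hI sI hM; apply: (@leq_exp2_trans _ (a + b + a + a)); last by lia.
apply: sumz_lt; last by rewrite size_map size_zip; apply: leq_trans (geq_minl _ _) sI.
elim: J M hI hM {sI} => [|r J IH] [|v M] //= /andP[/andP[hr sr] hI] /andP[hv hM].
by rewrite IH // andbT dot_lt.
Qed.

(** In order: l in unary, the rows of A, the number D^l, the columns of the identity, and the start
    vector. *)
Definition fl_ctx : Type := seq unit * seq (seq int) * int * seq (seq int) * seq int.
Definition fl_state : Type := seq (seq int) * seq int * (seq int * int).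

(* The Faddeev-LeVerrier recursion for [B = A ^ l - D ^ l]: [M] is its k-th matrix
   times (k - 1)!, which avoids divisions, and [x = M *m v0].  The last [x'] with a
   nonzero trace [t], divided by [- t], is the projection of [v0] onto the kernel of
   [B] along its image. *)
Definition fl_step (c : fl_ctx) (q : fl_state) (k : int) : fl_state :=
  let: (u, A, Dl, J, v0) := c in
  let: (M, x, best) := q in
  let BM := [seq shiftv u A Dl v | v <- M] in
  let t := trz J BM in
  let x' := lincomb k (- t) (shiftv u A Dl x) v0 in
  ([seq lincomb k (- t) p.1 p.2 | p <- zip BM J], x',
   if t == 0 then best else (x', - t)).

Definition fl_inv S b (q : fl_state) :=
  [&& all (fun v => vle b v && (size v <= S)%N) q.1.1, (size q.1.1 <= S)%N,
      vle b q.1.2, (size q.1.2 <= S)%N, vle b q.2.1, (size q.2.1 <= S)%N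
    & (`|q.2.2| < 2 ^ b)%N].

(** Growth is additive although the trace is about as long as the entries of M: the trace multiplies
    only the fixed [J] and [v0], and the shifted columns are multiplied only by the small [k]. The
    shift costs [2 * S * S + S + 2] bits, the trace and the combination [5 * S + 1] more. *)
Lemma fl_inv_step S b (u : seq unit) (A : seq (seq int)) (Dl : int)
    (J : seq (seq int)) (v0 : seq int) q (k : int) :
  (esize A <= S)%N -> (esize u <= S)%N -> (esize Dl <= S)%N ->
  (esize J <= S)%N -> (esize v0 <= S)%N -> (esize k <= S)%N ->
  fl_inv S b q -> fl_inv S (b + (2 * S * S + 6 * S + 3)) (fl_step (u, A, Dl, J, v0) q k).
Proof.
move=> hA hu hD hI hv hk; case: q => [[M x] [y c]] /and5P[/= hM sM hx sx /and3P[hy sy hc]].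
have rA := rows_esize hA; have rI := rows_esize hI.
have sI : (size J <= S)%N by have := @size_esize vecE J; rewrite /=; lia.
have su : (2 * S * size u <= 2 * S * S)%N.
  by rewrite leq_mul2l; apply/orP; right; have := @size_esize unit_encType u; rewrite /=; lia.
have vD : (`|Dl| < 2 ^ S)%N by apply: leq_exp2_trans (ltn_esize_int _) hD.
have vk : (`|k| < 2 ^ S)%N by apply: leq_exp2_trans (ltn_esize_int _) hk.
have hB v : vle b v -> vle (b + (2 * S * S + S + 2)) (shiftv u A Dl v).
  move=> vb; rewrite !addnS; apply: (shiftv_lt rA vb vD); lia.
set m := (b + (2 * S * S + S + 2))%N in hB.
set BM := [seq shiftv u A Dl v | v <- M].
have vBM : all (vle m) BM.
  by rewrite /BM all_map; apply: sub_all hM => v /andP[/hB].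
have vt : (`|- trz J BM| < 2 ^ (m + 3 * S))%N by rewrite abszN trz_lt.
have -> : (b + (2 * S * S + 6 * S + 3))%N = (m + 5 * S).+1 by rewrite /m; lia.
have vlin v w : vle m v -> vle S w ->
    vle (m + 5 * S).+1 (lincomb k (- trz J BM) v w).
  by move=> h1 h2; apply: (lincomb_lt vk vt h1 h2); lia.
have sv0 : (size v0 <= S)%N by have := @size_esize int_encType v0; rewrite /=; lia.
have vx : vle (m + 5 * S).+1 (lincomb k (- trz J BM) (shiftv u A Dl x) v0).
  by apply: vlin; [exact: hB|apply: vle_mono hv (vle_esize v0)].
have sx' : (size (lincomb k (- trz J BM) (shiftv u A Dl x) v0) <= S)%N.
  by apply: leq_trans (size_lincomb _ _ _ _) sv0.
have bm : (b <= (m + 5 * S).+1)%N by rewrite /m; lia.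
rewrite /fl_inv /fl_step -/BM /= vx sx' /=; set best := if _ then _ else _.
have [-> -> ->] : [/\ vle (m + 5 * S).+1 best.1, (size best.1 <= S)%N &
    (`|best.2| < 2 ^ (m + 5 * S).+1)%N].
  rewrite /best; case: ifP => _ /=; split=> //.
  - exact: vle_mono bm hy.
  - exact: leq_exp2_trans hc bm.
  - by apply: leq_exp2_trans vt _; lia.
apply/andP; split; last first.
  rewrite ?andbT size_map size_zip.
  by apply: leq_trans (geq_minr _ _) sI.
move: (trz J BM) vlin {sI vt vx sx' best} => t vlin.
elim: BM J vBM rI {hI} => [|v M' IH] [|w J'] //= /andP[hv' hM'] /andP[/andP[hw sw] hI'].
by rewrite IH // vlin //= andbT (leq_trans (size_lincomb _ _ _ _) sw).
Qed.

Lemma fl_inv_esize S b q : fl_inv S b q ->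
  (esize q <= (S + 2) * (1 + S * (4 * b + 6)) + 1 + S * (1 + 4 * b + 6) + 4 * b + 10)%N.
Proof.
case: q => [[M x] [y c]] /and5P[/= hM sM hx sx /and3P[hy sy hc]].
have l v : vle b v -> (size v <= S)%N -> (esize v <= 1 + S * (4 * b + 6))%N.
  move=> hv sv; apply: leq_trans (esize_vle hv) _.
  by rewrite leq_add2l leq_mul2r sv orbT.
have hM' : (esize M <= 1 + size M * (1 + S * (4 * b + 6)).+1)%N.
  elim: M hM {sM} => //= v M IH /andP[/andP[hv sv] hM]; rewrite esize_cons.
  by have := IH hM; have := l v hv sv; lia.
have hM2 : (size M * (1 + S * (4 * b + 6)).+1 <= S * (1 + S * (4 * b + 6)).+1)%N.
  by rewrite leq_mul2r sM orbT.
have := l _ hx sx; have := l _ hy sy; have := esize_int_le hc.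
rewrite !esize_pair; lia.
Qed.

Lemma FP_fl_step (T : encType) (u : T -> seq unit) (A : T -> seq (seq int)) (Dl : T -> int)
    (J : T -> seq (seq int)) (v0 : T -> seq int) (q : T -> fl_state) (k : T -> int) :
  FP u -> FP A -> FP Dl -> FP J -> FP v0 -> FP q -> FP k ->
  FP (fun t => fl_step (u t, A t, Dl t, J t, v0 t) (q t) (k t)).
Proof.
move=> hu hA hD hJ hv hq hk.
pose BM t := [seq shiftv (u t) (A t) (Dl t) v | v <- (q t).1.1].
pose tr t := trz (J t) (BM t).
pose x' t := lincomb (k t) (- tr t) (shiftv (u t) (A t) (Dl t) (q t).1.2) (v0 t).
have hBM : FP BM.
  rewrite /BM; fp => //; apply: FP_shiftv; fp.
  - exact: FP_comp (FP_fst (FP_id _)) hu.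
  - exact: FP_comp (FP_fst (FP_id _)) hA.
  - exact: FP_comp (FP_fst (FP_id _)) hD.
have htr : FP tr by exact: FP_trz.
have hx' : FP x'.
  by apply: FP_lincomb; fp => //; apply: FP_shiftv; fp.
apply: (@FP_ext _ _ (fun t => ([seq lincomb (k t) (- tr t) p.1 p.2 | p <- zip (BM t) (J t)],
   x' t, if tr t == 0 then (q t).2 else (x' t, - tr t)))).
  by move=> t; rewrite /fl_step /x' /tr /BM; case: (q t) => [[M x] best].
have hlin : FP (fun z : T * (vecE * vecE) => lincomb (k z.1) (- tr z.1) z.2.1 z.2.2).
  apply: FP_lincomb; fp.
  - exact: FP_comp (FP_fst (FP_id _)) hk.
  - exact: FP_comp (FP_fst (FP_id _)) htr.
by fp.
Qed.

End Loops.

Section MainLoop.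

Notation vecE := (seq_encType int_encType).
Notation matE := (seq_encType vecE).
Notation unaryE := (seq_encType unit_encType).

Lemma fl_inv_mono S b b' q : (b <= b')%N -> fl_inv S b q -> fl_inv S b' q.
Proof.
move=> hb /and5P[h1 h2 h3 h4 /and3P[h5 h6 h7]]; apply/and5P; split=> //.
- by apply: sub_all h1 => v /andP[hv ->]; rewrite (vle_mono hb hv).
- exact: vle_mono h3.
- by rewrite h6 (vle_mono hb h5) (leq_exp2_trans h7 hb).
Qed.

Lemma fl_inv_init S (q : fl_state) : (esize q <= S)%N -> fl_inv S S q.
Proof.
case: q => [[M x] [y c]]; rewrite !esize_pair => h.
have hM : (esize M <= S)%N by lia.
have sz (v : seq int) : (size v <= esize v)%N := @size_esize int_encType v.
apply/and5P; split=> /=.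
- exact: rows_esize.
- exact: leq_trans (@size_esize vecE M) hM.
- by apply: vle_mono (vle_esize x); lia.
- by apply: leq_trans (sz x) _; lia.
apply/and3P; split.
- by apply: vle_mono (vle_esize y); lia.
- by apply: leq_trans (sz y) _; lia.
- by apply: leq_exp2_trans (ltn_esize_int c) _; lia.
Qed.

Definition fl_loop (c : fl_ctx) (q : fl_state) (ks : seq int) := foldl (fl_step c) q ks.

Lemma FP_fl_loop (T : encType) (u : T -> seq unit) (A : T -> seq (seq int)) (Dl : T -> int)
    (J : T -> seq (seq int)) (v0 : T -> seq int) (q : T -> fl_state) (ks : T -> seq int) :
  FP u -> FP A -> FP Dl -> FP J -> FP v0 -> FP q -> FP ks ->
  FP (fun t => fl_loop (u t, A t, Dl t, J t, v0 t) (q t) (ks t)).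
Proof.
move=> hu hA hD hJ hv hq hks; rewrite /fl_loop.
pose ctxE := prod_encType (prod_encType (prod_encType (prod_encType unaryE matE) int_encType) matE) vecE.
pose stE := prod_encType (prod_encType matE vecE) (prod_encType vecE int_encType).
apply: (@FP_foldl T ctxE stE int_encType (fun q => fl_step q.1.1 q.1.2 q.2)
  (fun S => (S + 2) * (1 + S * (4 * (S + S * (2 * S * S + 6 * S + 3)) + 6)) + 1
     + S * (1 + 4 * (S + S * (2 * S * S + 6 * S + 3)) + 6)
     + 4 * (S + S * (2 * S * S + 6 * S + 3)) + 10)%N
  (fun t => (u t, A t, Dl t, J t, v0 t))) => //; [|by polyb| |by fp].
  apply: (@FP_ext _ _ (fun q : ctxE * stE * int =>
    fl_step (q.1.1.1.1.1.1, q.1.1.1.1.1.2, q.1.1.1.1.2, q.1.1.1.2, q.1.1.2) q.1.2 q.2)).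
    by move=> [[[[[[? ?] ?] ?] ?] ?] ?].
  by apply: FP_fl_step; fp.
move=> c q0 s /=; set S := (esize c + esize q0 + esize s)%N.
suff /fl_inv_esize h : fl_inv S (S + S * (2 * S * S + 6 * S + 3))
  (foldl (fun a x => fl_step c a x) q0 s) by exact: h.
have gen b (s' : seq int) q' : (esize s' <= S)%N -> fl_inv S b q' ->
    fl_inv S (b + size s' * (2 * S * S + 6 * S + 3)) (foldl (fun a x => fl_step c a x) q' s').
  elim: s' b q' => [|k s' IH] b q' /=; first by rewrite addn0.
  rewrite esize_cons mulSn addnA => hs hq'; apply: IH; first by lia.
  have : (esize c <= S)%N by rewrite /S; lia.
  case: (c) => [[[[u' A'] D'] J'] v'] /=; rewrite !esize_pair => hc.
  by apply: fl_inv_step => //; lia.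
apply: fl_inv_mono (gen S s q0 _ _); last 2 first.
- by rewrite /S; lia.
- by apply: fl_inv_init; exact: leq_trans (leq_addl (esize c) _) (leq_addr (esize s) _).
rewrite leq_add2l leq_mul2r; apply/orP; right.
by apply: leq_trans (@size_esize int_encType s) _; rewrite /S; lia.
Qed.

Definition pt_state : Type := seq int * int * seq (seq int * int).

(** The current point is y / c. Multiplying it by A / D multiplies y by A and c by D, with no
    fraction reduced inside the loop. *)
Definition pt_step A (D : int) (q : pt_state) : pt_state :=
  (mulv A q.1.1, q.1.2 * D, q.1 :: q.2).

Definition pt_loop A D (q : pt_state) (u : seq unit) :=
  foldl (fun q (_ : unit) => pt_step A D q) q u.

Lemma pt_loop_esize S b B (A : seq (seq int)) (D : int) y (c : int) outs (u : seq unit) :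
  (esize A <= S)%N -> (esize D <= S)%N ->
  vle b y -> (size y <= S)%N -> (`|c| < 2 ^ b)%N -> (b + 2 * S * size u <= B)%N ->
  (esize (pt_loop A D (y, c, outs) u) <= esize outs +
     (size u + 1) * (S * (4 * B + 6) + 4 * B + 9))%N.
Proof.
move=> hA hD; elim: u b y c outs => [|x u IH] b y c outs hy sy hc hB.
  have hE : (esize y <= 1 + S * (4 * B + 6))%N.
    apply: leq_trans (esize_vle (@vle_mono b B y _ hy)) _; first by move: hB; rewrite /=; lia.
    by rewrite leq_add2l leq_mul2r sy orbT.
  have hc' : (esize c <= 4 * B + 5)%N.
    by apply: esize_int_le; apply: leq_exp2_trans hc _; move: hB; rewrite /=; lia.
  by rewrite /= !esize_pair; lia.
have hE : (esize y <= 1 + S * (4 * B + 6))%N.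
  apply: leq_trans (esize_vle (@vle_mono b B y _ hy)) _; first by lia.
  by rewrite leq_add2l leq_mul2r sy orbT.
have hc' : (esize c <= 4 * B + 5)%N.
  by apply: esize_int_le; apply: leq_exp2_trans hc _; lia.
apply: leq_trans (IH (b + 2 * S)%N _ _ _ _ _ _ _) _.
- by apply: mulv_lt => //; apply: rows_esize.
- by rewrite size_mulv; apply: leq_trans (@size_esize vecE A) hA.
- rewrite abszM; apply: leq_exp2_trans (ltn_mul_exp hc (ltn_esize_int D)) _; lia.
- by move: hB; rewrite /=; lia.
by rewrite esize_cons esize_pair /=; lia.
Qed.

Lemma FP_pt_loop (T : encType) (A : T -> seq (seq int)) (D : T -> int)
    (q : T -> pt_state) (u : T -> seq unit) :
  FP A -> FP D -> FP q -> FP u -> FP (fun t => pt_loop (A t) (D t) (q t) (u t)).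
Proof.
move=> hA hD hq hu; rewrite /pt_loop.
pose ctxE := prod_encType matE int_encType.
pose stE := prod_encType (prod_encType vecE int_encType)
  (seq_encType (prod_encType vecE int_encType)).
apply: (@FP_foldl T ctxE stE unit_encType (fun q => pt_step q.1.1.1 q.1.1.2 q.1.2)
  (fun S => S + (S + 1) * (S * (4 * (S + 2 * S * S) + 6) + 4 * (S + 2 * S * S) + 9))%N
  (fun t => (A t, D t))) => //; [|by polyb| |by fp].
  by rewrite /pt_step; fp; apply: FP_mulv; fp.
move=> [A0 D0] [[y c] outs] u0 /=; rewrite -/(pt_loop A0 D0 _ u0).
rewrite !esize_pair; set S := (_ + _ + esize u0)%N.
have su : (size u0 <= S)%N by apply: leq_trans (@size_esize unit_encType u0) _; rewrite /S; lia.
apply: leq_trans (@pt_loop_esize S S (S + 2 * S * S) A0 D0 y c outs u0 _ _ _ _ _ _) _.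
- by rewrite /S; lia.
- by rewrite /S; lia.
- by apply: vle_mono (vle_esize y); rewrite /S; lia.
- by apply: leq_trans (@size_esize int_encType y) _; rewrite /S; lia.
- by apply: leq_exp2_trans (ltn_esize_int c) _; rewrite /S; lia.
- by rewrite leq_add2l leq_mul2l su orbT.
apply: leq_add; first by rewrite /S; lia.
by rewrite leq_mul2r leq_add2r su orbT.
Qed.

End MainLoop.

(** * The whole computation, given l in unary *)

Section Algorithm.

Notation vecE := (seq_encType int_encType).
Notation matE := (seq_encType vecE).
Notation unaryE := (seq_encType unit_encType).

Lemma FP_flatten (T A : encType) (s : T -> seq (seq A)) :
  FP s -> FP (fun t => flatten (s t)).
Proof.
move=> hs; have E ss a : foldl (fun a s => a ++ s) a ss = a ++ flatten ss :> seq A.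
  elim: ss a => [|s' ss IH] a /=; first by rewrite cats0.
  by rewrite IH catA.
apply: (@FP_ext _ _ (fun t => foldl (fun a s => a ++ s) [::] (s t))).
  by move=> t; rewrite E.
apply: (@FP_foldl T unit_encType (seq_encType A) (seq_encType A) (fun q => q.1.2 ++ q.2)
  (fun n => n) (fun=> tt)) => //; [by fp|by polyb| |by fp|by fp].
move=> c a ss /=; rewrite E.
have /= h := esize_cat a (flatten ss).
suff : (esize (flatten ss) <= esize ss)%N by lia.
elim: ss {h} => //= s' ss IH; rewrite esize_cons.
by have /= := esize_cat s' (flatten ss); lia.
Qed.

Lemma FP_prodn (T : encType) (s : T -> seq nat) :
  FP s -> FP (fun t => foldl muln 1%N (s t)).
Proof.
move=> hs.
apply: (@FP_foldl T unit_encType nat_encType nat_encType (fun q => q.1.2 * q.2)%N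
  (fun n => 4 * n + 1)%N (fun=> tt)) => //; [by fp|by polyb| |by fp|by fp].
move=> c a s' /=.
apply: leq_trans (esize_nat_le (b := esize a + esize s') _) _; last by lia.
have := ltn_esize a; move: (esize a) => k.
elim: s' a k => [|x s' IH] a k /= h; first by apply: leq_exp2_trans h _; lia.
apply: leq_exp2_trans (IH _ (k + esize x)%N _) _; last by rewrite esize_cons; lia.
exact: ltn_mul_exp h (ltn_esize x).
Qed.

Definition index_step (q : nat * seq nat) := ((q.1 + 1)%N, q.1 :: q.2).

(** The list serves as a unary counter: enumerating the numbers below a binary n would take time
    exponential in its length. *)
Definition indices (X : Type) (s : seq X) : seq nat :=
  rev (foldl (fun q (_ : X) => index_step q) (0%N, [::]) s).2.

Lemma index_foldl (X : Type) (s : seq X) n r :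
  foldl (fun q (_ : X) => index_step q) (n, r) s
    = (n + size s, catrev (iota n (size s)) r)%N.
Proof.
elim: s n r => [|x s IH] n r /=; first by rewrite addn0.
by rewrite IH /= addn1 addSnnS.
Qed.

Lemma indicesE (X : Type) (s : seq X) : indices s = iota 0 (size s).
Proof. by rewrite /indices index_foldl -/(rev _) revK. Qed.

Lemma FP_indices (T X : encType) (s : T -> seq X) : FP s -> FP (fun t => indices (s t)).
Proof.
move=> hs; apply: FP_rev; apply: FP_snd.
apply: (@FP_foldl T unit_encType (prod_encType nat_encType (seq_encType nat_encType)) X
  (fun q => index_step q.1.2)
  (fun n => (4 * n + 1) + n + (n + 1) * (4 * n + 3) + 1)%N (fun=> tt)) => //;
  [by rewrite /index_step; fp|by polyb| |by fp|by fp].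
move=> c [n r] s' /=; rewrite index_foldl !esize_pair.
set N := (esize c + _ + _)%N.
have hs' : (size s' <= esize s')%N by exact: size_esize.
have hn m : (m <= n + size s')%N -> (esize m <= 4 * N + 1)%N.
  move=> hm; apply: esize_nat_le; apply: leq_ltn_trans hm _.
  apply: leq_exp2_trans (exp2_leD (ltn_esize n) (ltn_expl _ (ltnSn 1))) _.
  by rewrite /N; lia.
rewrite catrevE; have /= := esize_cat (rev (iota n (size s'))) r; rewrite esize_rev.
suff : (esize (iota n (size s')) <= (N + 1) * (4 * N + 3))%N.
  by have := hn _ (leqnn _); rewrite {3 4}/N; lia.
have gen k m : (m + k <= n + size s')%N -> (esize (iota m k) <= (k + 1) * (4 * N + 3))%N.
  elim: k m => [|k IH] m hm; first by rewrite /= -[esize _]/1%N; lia.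
  rewrite /= esize_cons; have := IH m.+1 ltac:(lia); have := hn m ltac:(lia); lia.
apply: leq_trans (gen _ _ (leqnn _)) _; rewrite leq_mul2r leq_add2r.
by rewrite orbC /N; apply/orP; left; lia.
Qed.

Definition idmat (idx : seq nat) : seq (seq int) :=
  [seq [seq if (i <= j)%N && (j <= i)%N then 1 else 0 | j <- idx] | i <- idx].

Lemma FP_idmat (T : encType) (s : T -> seq nat) : FP s -> FP (fun t => idmat (s t)).
Proof.
move=> hs; rewrite /idmat; fp => //.
by apply: FP_comp (FP_fst (FP_id _)) hs.
Qed.

(** A product rather than a least common multiple: the bit lengths of the denominators merely add
    up, so it is short enough. *)
Definition common_den (x : seq (seq rat) * seq rat) : nat :=
  foldl muln 1%N [seq `|denq q|%N | q <- flatten x.1 ++ x.2].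

Definition scale (D : nat) (q : rat) : int := numq q * (D %/ `|denq q|)%N%:Z.

(** The default candidate [(v0, 1)] belongs to the leading coefficient of the characteristic
    polynomial, which is 1. The power D^l is a product over the unary counter. *)
Definition limit_data (u : seq unit) (A : seq (seq int)) (D : nat) (v0 : seq int) :=
  let J := idmat (indices v0) in
  (fl_loop (u, A, (foldl muln 1%N [seq D | _ <- u])%:Z, J, v0) (J, v0, (v0, 1))
    [seq k.+1%:Z | k <- indices v0]).2.

(** [v0] stands for D times the initial distribution, which accounts for the extra factor [D] in the
    first denominator. *)
Definition int_points (u : seq unit) (A : seq (seq int)) (D : nat) (v0 : seq int) :=
  let q := limit_data u A D v0 in
  rev (pt_loop A D (q.1, q.2 * D%:Z, [::]) u).2.

Definition ergodic_points (u : seq unit) (x : seq (seq rat) * seq rat) : seq (seq rat) :=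
  let D := common_den x in
  [seq [seq z%:Q / p.2%:Q | z <- p.1] |
    p <- int_points u [seq [seq scale D q | q <- r] | r <- x.1] D
                      [seq scale D q | q <- x.2]].

Lemma FP_int_points (T : encType) u A D v0 :
  FP u -> FP A -> FP D -> FP v0 ->
  FP (fun t : T => int_points (u t) (A t) (D t) (v0 t)).
Proof.
move=> hu hA hD hv.
have hJ : FP (fun t => idmat (indices (v0 t))).
  by apply: FP_idmat; apply: FP_indices.
have hq : FP (fun t => limit_data (u t) (A t) (D t) (v0 t)).
  apply: FP_snd; apply: FP_fl_loop; fp => //.
  - apply: FP_prodn; fp => //; exact: FP_comp (FP_fst (FP_id _)) hD.
  - apply: (@FP_ext _ _ (fun q : T * nat => (q.2 + 1)%N)); last by fp.
    by move=> q; rewrite addn1.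
  - exact: FP_indices.
apply: FP_rev; apply: FP_snd; apply: FP_pt_loop; fp => //.
Qed.

Lemma FP_ergodic_points (T : encType) (u : T -> seq unit) (x : T -> seq (seq rat) * seq rat) :
  FP u -> FP x -> FP (fun t => ergodic_points (u t) (x t)).
Proof.
move=> hu hx.
have hD : FP (fun t => common_den (x t)).
  apply: FP_prodn; fp => //.
  by apply: FP_flatten; fp.
have hsc : FP (fun q : T * rat => scale (common_den (x q.1)) q.2).
  rewrite /scale; fp.
  exact: FP_comp (FP_fst (FP_id _)) hD.
rewrite /ergodic_points; fp.
- apply: FP_divz; fp.
- apply: FP_int_points; fp => //.
  by apply: (FP_comp (f := fun q : T * seq rat * rat => (q.1.1, q.2)) _ hsc); fp.
Qed.

End Algorithm.

(** * The factorial in unary *)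

Section ExponentialPhase.

(** The state is k! and k in unary. Its size is not polynomial in the input, so the loop is run
    through [fold_within] and not through [FP_foldl]. *)
Definition fact_step (q : seq unit * seq unit) : seq unit * seq unit :=
  (flatten [seq q.1 | _ <- tt :: q.2], tt :: q.2).

Definition unary_fact (X : Type) (s : seq X) : seq unit :=
  (foldl (fun q (_ : X) => fact_step q) ([:: tt], [::]) s).1.

Lemma fact_foldl (X : Type) (s : seq X) :
  let q := foldl (fun q (_ : X) => fact_step q) ([:: tt], [::]) s in
  size q.1 = (size s)`! /\ size q.2 = size s.
Proof.
elim/last_ind: s => [|s x [IH1 IH2]] //=; rewrite -cats1 foldl_cat /=.
move: (foldl _ _ s) IH1 IH2 => q h1 h2.
split; last by rewrite /= h2 size_cat addn1.
rewrite size_cat size_cat addn1 factS -h1 -h2 mulSn; congr addn.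
by elim: (q.2) => //= y r IH; rewrite size_cat IH mulSn.
Qed.

Lemma size_unary_fact (X : Type) (s : seq X) : size (unary_fact s) = (size s)`!.
Proof. by have [] := fact_foldl s. Qed.

Lemma esize_unary (u : seq unit) : esize u = (2 * size u + 1)%N.
Proof. by elim: u => // x u IH; rewrite esize_cons IH -[esize x]/1%N /=; lia. Qed.

Lemma ergodic_points_time :
  exists (M : program) (k : nat), forall x : seq (seq rat) * seq rat,
    evaluates_within M [:: enc x] (nth ENil M 0)
      (enc (ergodic_points (unary_fact x.2) x))
      ((2 * (size x.2)`! + 2 * esize x + 5) ^ k)%N.
Proof.
pose unE := seq_encType unit_encType.
pose stE := prod_encType unE unE.
pose xE := prod_encType (seq_encType (seq_encType rat_encType)) (seq_encType rat_encType).
have [c1 [s1 [e1 [k1 [hs1 h1]]]]] :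
    FP (fun x : xE => (tt, ([:: tt], [::]) : stE, x.2)) by fp.
have hstep : FP (fun q : unit_encType * stE * rat => fact_step q.1.2).
  by rewrite /fact_step; apply: FP_pair; [apply: FP_flatten|]; fp.
have [c2 [s2 [e2 [k2 [hs2 h2]]]]] := fold_within hstep.
have [c3 [s3 [e3 [k3 [hs3 h3]]]]] :
    FP (fun q : stE * xE => ergodic_points q.1.1 q.2) by apply: FP_ergodic_points; fp.
pose b2 := (1 + s1)%N; pose b3 := (b2 + s2)%N.
(* Function 0 is [entry], and the three blocks follow from index 1. After two bindings, variable 0
   is the final loop state and variable 2 the input, whose vector served as a unary counter of
   length d. *)
pose entry := ELet (e1 1%N) (ELet (e2 b2) (ELet (ECons (EVar 0) (EVar 2)) (e3 b3))).
pose M := entry :: (c1 1%N ++ (c2 b2 ++ c3 b3)).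
have pM : placed M 1 (c1 1%N ++ (c2 b2 ++ c3 b3)) by [].
have [p1] := placed_cat pM; rewrite hs1 => /placed_cat[p2]; rewrite hs2 => p3.
have [k hk] : polybounded (fun S => ((S + 2) ^ k1 + (S + 2) ^ k2 + (S + S + 3) ^ k3 + 10)%N).
  by polyb.
exists M, k => x; rewrite [nth _ _ _]/=.
(* A unary N is a tree of size 2 N + 1. The loop state holds k! and k for some k <= d, and fits into
   S since d is less than the size of [x]. *)
set S := (2 * (size x.2)`! + 2 * esize x + 3)%N.
have -> : (2 * (size x.2)`! + 2 * esize x + 5 = S + 2)%N by rewrite /S; lia.
have hxS : (esize x <= S)%N by rewrite /S; lia.
have hst i : (esize (foldl (fun q (_ : rat) => fact_step q) ([:: tt], [::]) (take i x.2)) <= S)%N.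
  have [] := fact_foldl (take i x.2); case: (foldl _ _ _) => u m /= hu hm.
  rewrite esize_pair !esize_unary hu hm size_take_min.
  have : (minn i (size x.2) <= size x.2)%N by exact: geq_minr.
  move=> hmin; have : ((minn i (size x.2))`! <= (size x.2)`!)%N.
    exact: leq_fact.
  move: hmin; have : (size x.2 < esize x)%N.
    case: (x) => P v; rewrite esize_pair /=.
    by have := @size_esize rat_encType v; rewrite /=; lia.
  by rewrite /S; lia.
have [w1 _] := h1 M 1%N p1 x [::].
have w2 := h2 M b2 p2 tt ([:: tt], [::]) x.2 S [:: enc x] hst _ _.
have hx2 : (esize x.2 <= S)%N.
  by apply: leq_trans hxS; case: (x) => P v; rewrite esize_pair /=; lia.
have htt : (esize tt <= S)%N by rewrite -[esize tt]/1%N /S; lia.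
have {}w2 := w2 htt hx2.
pose st := foldl (fun q (_ : rat) => fact_step q) ([:: tt], [::]) x.2 : stE.
have [w3 _] := h3 M b3 p3 (st, x) [:: enc st; enc (tt, ([:: tt], [::]) : stE, x.2 : seq rat); enc x].
have v : evaluates_within M [:: enc st; enc (tt, ([:: tt], [::]) : stE, x.2 : seq rat); enc x]
    (ECons (EVar 0) (EVar 2)) (enc (st, x)) 3.
  by apply: (within_cons (within_var _ _) (within_var _ _)).
apply: within_le (within_let w1 (within_let w2 (within_let v w3))) _.
apply: leq_trans (hk S).
have hle m a b : (a <= b)%N -> (a ^ m <= b ^ m)%N by case: m => // m h; rewrite leq_exp2r.
have hst' : (esize st <= S)%N.
  by have := hst (size x.2); rewrite take_size.
have h5 : ((esize x + 2) ^ k1 <= (S + 2) ^ k1)%N by apply: hle; rewrite leq_add2r.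
have h4 : ((esize (st, x) + 2) ^ k3 <= (S + S + 3) ^ k3)%N.
  by apply: hle; rewrite esize_pair; lia.
move: h4 h5; rewrite -/xE; lia.
Qed.

End ExponentialPhase.

(** * Correctness of the algorithm *)

Section FaddeevLeVerrier.

Lemma deriv_prod (R : comNzRingType) (I : finType) (F : I -> {poly R}) :
  (\prod_i F i)^`() = \sum_i (F i)^`() * \prod_(j | i != j) F j.
Proof.
elim: (index_enum I) (index_enum_uniq I) => [|x s IH] /=.
  by rewrite !big_nil derivC.
move=> /andP[xs us]; rewrite !big_cons derivM {}IH // eqxx /=; congr (_ * _ + _).
  rewrite big_seq [RHS]big_seq_cond; apply: eq_bigl => j.
  by case: (eqVneq x j) => [<-|]; rewrite ?andbT ?andbF // (negbTE xs).
rewrite big_distrr /= big_seq [RHS]big_seq; apply: eq_bigr => i si.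
have ix : i != x by apply: contraNneq xs => <-.
by rewrite big_cons ix mulrCA.
Qed.

(** Jacobi's formula. In the Leibniz expansion only diagonal factors depend on X, so differentiating
    factor i leaves the permutations that fix i, and these make up the i-th diagonal cofactor. *)
Lemma deriv_char_poly (R : comNzRingType) n (B : 'M[R]_n) :
  (char_poly B)^`() = \tr (\adj (char_poly_mx B)).
Proof.
rewrite /char_poly /determinant raddf_sum /mxtrace.
have E (b : bool) (f : {poly R}) : ((-1) ^+ b * f)^`() = (-1) ^+ b * f^`().
  by case: b; rewrite ?mul1r // !mulN1r derivN.
under eq_bigr => s _ do rewrite /= E deriv_prod mulr_sumr.
rewrite exchange_big; apply: eq_bigr => i _ /=.
rewrite mxE expand_cofactor [RHS]big_mkcond /=; apply: eq_bigr => s _.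
rewrite !mxE derivB derivC subr0.
rewrite [i == s i]eq_sym; case: eqP => si; first by rewrite mulr1n derivX mul1r.
by rewrite mulr0n deriv0 mul0r mulr0.
Qed.

Variables (R : idomainType) (n : nat) (B : 'M[R]_n.+1).
Let p := char_poly B.

(** The Horner tail, the sum of p_j B^(j-m) over j >= m. If p = X^m h, this is h(B), and p_m =
    h(0). *)
Definition tail_mx m : 'M[R]_n.+1 := horner_mx B (drop_poly m p).

Lemma tail_mxE m : tail_mx m = (p`_m)%:M + B *m tail_mx m.+1.
Proof.
have E : drop_poly m p = (p`_m)%:P + 'X * drop_poly m.+1 p.
  apply/polyP => i; rewrite coefD coefC coefXM !coef_drop_poly.
  by case: i => [|i]; rewrite ?addr0 ?add0n ?add0r ?addSnnS.
by rewrite /tail_mx E rmorphD rmorphM /= horner_mx_C horner_mx_X.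
Qed.

Lemma tail_mx0 : tail_mx 0 = 0.
Proof. by rewrite /tail_mx drop_poly0l Cayley_Hamilton. Qed.

Lemma tail_mx_big m : (n.+1 < m)%N -> tail_mx m = 0.
Proof.
move=> h; rewrite /tail_mx drop_poly_eq0 ?rmorph0 //.
by rewrite size_char_poly.
Qed.

Lemma tail_mx_lead : tail_mx n.+1 = 1.
Proof.
rewrite tail_mxE tail_mx_big // mulmx0 addr0.
have /monicP := char_poly_monic B.
by rewrite lead_coefE size_char_poly /= => ->.
Qed.

(** The Horner recurrence says that the right-hand side W satisfies (X - B) W = p. Multiplying by
    the adjugate gives p adj(X - B) = p W, and the nonzero p cancels entrywise. *)
Lemma adj_char_poly_mx :
  \adj (char_poly_mx B) = \matrix_(i, j) \poly_(m < n.+1) tail_mx m.+1 i j.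
Proof.
set W := \matrix_(i, j) _.
have WE i j m : (W i j)`_m = tail_mx m.+1 i j.
  rewrite mxE coef_poly; case: ltnP => // h.
  by rewrite tail_mx_big // mxE.
have CW : char_poly_mx B *m W = p%:M.
  apply/matrixP => i j; rewrite mulmxBl mul_scalar_mx; apply/polyP => m.
  have -> : ('X *: W - map_mx polyC B *m W) i j = 'X * W i j - \sum_k (B i k)%:P * W k j.
    rewrite [LHS]mxE [X in X + _]mxE [X in _ + X]mxE [X in - X]mxE; congr (_ - _).
    by apply: eq_bigr => k _; rewrite [map_mx _ _ _ _]mxE.
  have -> : p%:M i j = p *+ (i == j) by rewrite mxE.
  rewrite coefB coefXM.
  have -> : (\sum_k (B i k)%:P * W k j)`_m = (B *m tail_mx m.+1) i j.
    by rewrite coef_sum [RHS]mxE; apply: eq_bigr => k _; rewrite coefCM WE.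
  have -> : (if m == 0%N then 0 else (W i j)`_m.-1) = tail_mx m i j.
    by rewrite WE; case: (m) => [|m'] //=; rewrite tail_mx0 mxE.
  rewrite [tail_mx m]tail_mxE [X in X - _]mxE addrK mxE coefMn.
  by case: eqP.
have p0 : p != 0 by apply: monic_neq0; apply: char_poly_monic.
have E : p *: \adj (char_poly_mx B) = p *: W.
  by rewrite -mul_mx_scalar -CW mulmxA mul_adj_mx -mul_scalar_mx.
apply/matrixP => i j; have /matrixP/(_ i j) := E; rewrite !mxE.
by move/(mulfI p0).
Qed.

(** Newton's identities: coefficients are compared in Jacobi's formula, with the adjugate expanded
    in Horner tails. *)
Lemma trace_tail_mx m : (m <= n.+1)%N -> \tr (tail_mx m) = p`_m *+ m.
Proof.
case: m => [|m] hm; first by rewrite tail_mx0 mxtrace0.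
rewrite -coef_deriv deriv_char_poly adj_char_poly_mx /mxtrace coef_sum.
by apply: eq_bigr => i _; rewrite mxE coef_poly hm.
Qed.

(** The classical N_k = B N_(k-1) - tr(B N_(k-1)) / k, multiplied through by k!. *)
Fixpoint fl_mx k : 'M[R]_n.+1 :=
  if k is k'.+1 then k%:R *: (B *m fl_mx k') - (\tr (B *m fl_mx k'))%:M else 1.

(** For j = n - k, the trace of B times tail j + 1 is that of tail j minus (n + 1) p_j, which is (j
    - n - 1) p_j = -(k + 1) p_j. The formula for [fl_mx k] is a hypothesis because its inductive
    proof uses this trace. *)
Lemma fl_trace_tail k : (k <= n)%N -> fl_mx k = k`!%:R *: tail_mx (n.+1 - k) ->
  \tr (B *m fl_mx k) = - ((k.+1)`!%:R * p`_(n - k)).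
Proof.
move=> hk ->; rewrite -scalemxAr mxtraceZ subSn //.
have := trace_tail_mx (leq_trans (leq_subr k n) (leqnSn n)).
rewrite tail_mxE mxtraceD mxtrace_scalar => h.
have -> : \tr (B *m tail_mx (n - k).+1) = p`_(n - k) *+ (n - k) - p`_(n - k) *+ n.+1.
  by rewrite -h addrAC subrr add0r.
have -> : p`_(n - k) *+ (n - k) - p`_(n - k) *+ n.+1 = - (p`_(n - k) *+ k.+1).
  by rewrite -[X in _ - _ *+ X](subnK (leqW hk)) subSn // addSnnS mulrnDr opprD addrA subrr add0r.
by rewrite mulrN factS -[p`_(n - k) *+ _]mulr_natl natrM mulrA [k.+1%:R * _]mulrC.
Qed.

Lemma fl_mxE k : (k <= n.+1)%N -> fl_mx k = k`!%:R *: tail_mx (n.+1 - k).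
Proof.
elim: k => [|k IH] hk; first by rewrite subn0 tail_mx_lead scale1r.
have {}IH := IH (ltnW hk).
rewrite /= fl_trace_tail // IH -scalemxAr scalerA -natrM -factS.
rewrite subSS subSn // [in RHS]tail_mxE scalerDr scale_scalar_mx.
by rewrite raddfN opprK addrC.
Qed.

Lemma fl_trace k : (k <= n)%N -> \tr (B *m fl_mx k) = - ((k.+1)`!%:R * p`_(n - k)).
Proof. by move=> hk; apply: fl_trace_tail => //; apply: fl_mxE; apply: leqW. Qed.

End FaddeevLeVerrier.

(** * From lists to matrices *)

Section MatrixLists.

Definition rowsof (R : Type) m n (A : 'M[R]_(m, n)) : seq (seq R) :=
  [seq [seq A i j | j <- enum 'I_n] | i <- enum 'I_m].

Definition colof (R : Type) n (v : 'cV[R]_n) : seq R := [seq v i 0 | i <- enum 'I_n].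

(** The matrices of the recursion are listed by columns, since B acts on each column through
    [shiftv]; the matrix A is listed by rows, as [mulv] needs. *)
Definition colsof (R : Type) m n (A : 'M[R]_(m, n)) : seq (seq R) :=
  [seq colof (col j A) | j <- enum 'I_n].

Lemma sumzE s : sumz s = \sum_(z <- s) z.
Proof.
suff E a : foldl (fun a x => a + x) a s = a + \sum_(z <- s) z by rewrite /sumz E add0r.
elim: s a => [|x s IH] a /=; first by rewrite big_nil addr0.
by rewrite IH big_cons addrA.
Qed.

Lemma zip_map2 (T X Y : Type) (f : T -> X) (g : T -> Y) s :
  zip (map f s) (map g s) = [seq (f x, g x) | x <- s].
Proof. by elim: s => //= x s ->. Qed.

Lemma dot_map n (f g : 'I_n -> int) :
  dot (map f (enum 'I_n)) (map g (enum 'I_n)) = \sum_i f i * g i.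
Proof.
by rewrite /dot zip_map2 -map_comp sumzE big_map big_enum.
Qed.

Lemma mulv_rowsof m n (A : 'M[int]_(m, n)) (v : 'cV_n) :
  mulv (rowsof A) (colof v) = colof (A *m v).
Proof.
rewrite /mulv /rowsof -map_comp; apply: eq_map => i /=.
by rewrite dot_map mxE.
Qed.

Lemma lincomb_colof n (a b : int) (x y : 'cV_n) :
  lincomb a b (colof x) (colof y) = colof (a *: x + b *: y).
Proof.
by rewrite /lincomb zip_map2 -map_comp; apply: eq_map => i /=; rewrite !mxE.
Qed.

Lemma powv_rowsof n u (A : 'M[int]_n) (v : 'cV_n) :
  powv u (rowsof A) (colof v) = colof (A ^+ size u *m v).
Proof.
rewrite /powv; elim: u v => [|x u IH] v /=; first by rewrite expr0 mul1mx.
by rewrite mulv_rowsof IH exprSr -mulmxA.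
Qed.

Lemma shiftv_rowsof n u (A : 'M[int]_n) (c : int) (v : 'cV_n) :
  shiftv u (rowsof A) c (colof v) = colof ((A ^+ size u - c%:M) *m v).
Proof.
by rewrite /shiftv powv_rowsof lincomb_colof scale1r mulmxBl mul_scalar_mx scaleNr.
Qed.

Lemma trz_colsof n (M : 'M[int]_n) : trz (colsof (1%:M : 'M[int]_n)) (colsof M) = \tr M.
Proof.
rewrite /trz zip_map2 -map_comp sumzE big_map big_enum /=.
apply: eq_bigr => j _; rewrite dot_map (bigD1 j) //= big1 => [|i ij].
  by rewrite !mxE eqxx mul1r addr0.
by rewrite !mxE (negbTE ij) mul0r.
Qed.

Lemma idmat_colsof n : idmat (iota 0 n) = colsof (1%:M : 'M[int]_n).
Proof.
rewrite /idmat -val_enum_ord -map_comp; apply: eq_map => j /=.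
rewrite -map_comp; apply: eq_map => i /=.
by rewrite !mxE -eqn_leq -val_eqE eq_sym; case: eqP.
Qed.

Section FL.
Variables (n : nat) (A : 'M[int]_n.+1) (u : seq unit) (c : int) (v : 'cV[int]_n.+1).
Let B := A ^+ size u - c%:M.

Fixpoint fl_best k : 'cV[int]_n.+1 * int :=
  if k is k'.+1 then
    let t := \tr (B *m fl_mx B k') in
    if t == 0 then fl_best k' else (fl_mx B k *m v, - t)
  else (v, 1).

Lemma fl_loopE k :
  fl_loop (u, rowsof A, c, colsof (1%:M : 'M[int]_n.+1), colof v)
    (colsof (1%:M : 'M[int]_n.+1), colof v, (colof v, 1)) [seq i.+1%:Z | i <- iota 0 k]
  = (colsof (fl_mx B k), colof (fl_mx B k *m v), (colof (fl_best k).1, (fl_best k).2)).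
Proof.
elim: k => [|k IH]; first by rewrite /= mul1mx.
rewrite /fl_loop in IH *; rewrite -[k.+1]addn1 iotaD map_cat foldl_cat IH add0n [foldl _ _ _]/=.
have E w : shiftv u (rowsof A) c (colof w) = colof (B *m w) by exact: shiftv_rowsof.
have EM : [seq shiftv u (rowsof A) c w | w <- colsof (fl_mx B k)] = colsof (B *m fl_mx B k).
  by rewrite /colsof -map_comp; apply: eq_map => j /=; rewrite E !colE mulmxA.
rewrite EM trz_colsof E; set t := \tr _.
(* A column of M and the vector x follow the same recursion, started at a column of the identity and
   at v, so [EX] is used for both. *)
have EX w : lincomb k.+1 (- t) (colof (B *m (fl_mx B k *m w))) (colof w)
   = colof (fl_mx B k.+1 *m w).
  rewrite lincomb_colof /=; congr colof; rewrite [in RHS]mulmxBl mul_scalar_mx scaleNr; congr (_ - _); first by rewrite -natz mulmxA scalemxAl.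
rewrite addn1 EX; congr (_, _, _); last by rewrite /= -/t; case: ifP.
rewrite zip_map2 -map_comp; apply: eq_map => j.
rewrite [LHS]/= !colE mul1mx -mulmxA; exact: EX.
Qed.

Lemma indices_colof : indices (colof v) = iota 0 n.+1.
Proof. by rewrite indicesE size_map size_enum_ord. Qed.

(** Up to nonzero factorials, the traces are the coefficients of the characteristic polynomial from
    the top down, so the last nonzero trace marks the lowest nonzero coefficient met so far. *)
Lemma fl_bestE k : (k <= n.+1)%N ->
  exists r : nat, [/\ (r <= k)%N, (char_poly B)`_(n.+1 - r) != 0,
    fl_best k = (r`!%:R *: (tail_mx B (n.+1 - r) *m v), r`!%:R * (char_poly B)`_(n.+1 - r)) &
    forall i, (n.+1 - k <= i < n.+1 - r)%N -> (char_poly B)`_i = 0].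
Proof.
elim: k => [|k IH] hk.
  have E : (char_poly B)`_(n.+1 - 0) = 1.
    have /monicP := char_poly_monic B.
    by rewrite lead_coefE size_char_poly subn0.
  exists 0%N; rewrite E; split=> //.
    by rewrite mulr1 subn0 tail_mx_lead scale1r mul1mx.
  by move=> i; rewrite ltnNge; case: leqP.
have [r [rk pr E hr]] := IH (ltnW hk).
have -> : fl_best k.+1 = if \tr (B *m fl_mx B k) == 0 then fl_best k
  else (fl_mx B k.+1 *m v, - \tr (B *m fl_mx B k)) by [].
rewrite fl_trace // oppr_eq0 mulf_eq0 opprK fl_mxE // subSS.
have f0 m : (m`!%:R : int) != 0 by rewrite pnatr_eq0 -lt0n fact_gt0.
rewrite (negbTE (f0 _)) /=; case: eqP => pk.
  exists r; split=> //; first exact: leqW.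
  move=> i; rewrite leq_eqVlt => /andP[/orP[/eqP <- //|hi] hi2].
  by apply: hr; rewrite hi2 andbT subSn.
exists k.+1; rewrite subSS; split=> //; first exact/eqP.
  by rewrite -scalemxAl.
by move=> i /andP[h1 h2]; lia.
Qed.

End FL.

Lemma limit_dataE n (A : 'M[int]_n.+1) (u : seq unit) (D : nat) (v : 'cV[int]_n.+1) :
  let B := A ^+ size u - ((D ^ size u)%N%:Z)%:M in
  exists m (k : int), [/\ k != 0, (char_poly B)`_m != 0,
    forall i, (i < m)%N -> (char_poly B)`_i = 0 &
    limit_data u (rowsof A) D (colof v) =
      (colof (k *: (tail_mx B m *m v)), k * (char_poly B)`_m)].
Proof.
move=> B.
have [r [rk pr E hr]] := fl_bestE A u ((D ^ size u)%N%:Z) v (leqnn n.+1).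
have f0 : (r`!%:R : int) != 0 by rewrite pnatr_eq0 -lt0n fact_gt0.
(* After n + 1 rounds all coefficients have been met. The factor r! is common to the vector and its
   denominator and cancels later. *)
exists (n.+1 - r)%N, r`!%:R; split=> //.
  by move=> i hi; apply: hr; rewrite subnn.
rewrite /limit_data indices_colof idmat_colsof.
have -> : foldl muln 1%N [seq D | _ <- u] = (D ^ size u)%N.
  have gen a : foldl muln a [seq D | _ <- u] = (a * D ^ size u)%N.
    by elim: (u) a => [|x s IH] a /=; rewrite ?muln1 // IH expnS mulnA.
  by rewrite gen mul1n.
by rewrite fl_loopE E.
Qed.

Lemma pt_loopE n (A : 'M[int]_n) (D : int) (v : 'cV[int]_n) c outs (u : seq unit) :
  (pt_loop (rowsof A) D (colof v, c, outs) u).2 =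
  catrev [seq (colof (A ^+ i *m v), c * D ^+ i) | i <- iota 0 (size u)] outs.
Proof.
elim: u v c outs => [|x u IH] v c outs //.
rewrite /pt_loop /= -/(pt_loop _ _ _ _) /pt_step /= mulv_rowsof IH.
rewrite expr0 mul1mx mulr1; congr catrev.
rewrite (iotaDl 1 0) -map_comp; apply: eq_map => i /=.
by rewrite add1n mulmxA [A ^+ i.+1]exprSr [D ^+ i.+1]exprS mulrA.
Qed.
End MatrixLists.

(** * Back to rational matrices *)

Section RationalPoints.

Lemma common_den_gt0 x : (0 < common_den x)%N.
Proof.
rewrite /common_den.
suff gen (s : seq rat) a : (0 < a)%N -> (0 < foldl muln a [seq `|denq q|%N | q <- s])%N.
  exact: gen.
elim: s a => //= q s IH a a0.
by apply: IH; rewrite muln_gt0 a0 absz_gt0 denq_neq0.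
Qed.

Lemma dvdn_common_den x q : q \in flatten x.1 ++ x.2 -> (`|denq q| %| common_den x)%N.
Proof.
rewrite /common_den; move: (_ ++ _) => s.
have gen (t : seq nat) a d : (d %| a)%N || (d \in t) -> (d %| foldl muln a t)%N.
  elim: t a => [|b t IH] a /=; first by rewrite orbF.
  rewrite inE => h; apply: IH; case/or3P: h => [h|/eqP ->|->].
  - by rewrite dvdn_mulr.
  - by rewrite dvdn_mull.
  - by rewrite orbT.
by move=> qs; apply: gen; rewrite (map_f (fun q => `|denq q|%N)) ?orbT.
Qed.

Lemma scaleE (D : nat) q : (`|denq q| %| D)%N -> (scale D q)%:Q = D%:R * q.
Proof.
move=> /divnK E; rewrite /scale intrM -[in RHS]E natrM -[X in _ = _ * X]divq_num_den.
rewrite -[(`|denq q|%N)%:R]/(`|denq q|%N%:Z%:~R) absz_denq -pmulrn.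
have d0 : (denq q)%:~R != 0 :> rat by rewrite intr_eq0 denq_neq0.
move: (_ %/ _)%N ((numq q)%:~R : rat) ((denq q)%:~R : rat) d0 => k x y y0.
by field.
Qed.

Lemma map_rowsof (R S : Type) (f : R -> S) m n (A : 'M[R]_(m, n)) :
  [seq [seq f a | a <- r] | r <- rowsof A] = rowsof (map_mx f A).
Proof.
rewrite /rowsof -map_comp; apply: eq_map => i /=.
by rewrite -map_comp; apply: eq_map => j /=; rewrite mxE.
Qed.

Lemma map_colof (R S : Type) (f : R -> S) n (v : 'cV[R]_n) :
  [seq f a | a <- colof v] = colof (map_mx f v).
Proof. by rewrite /colof -map_comp; apply: eq_map => i /=; rewrite mxE. Qed.

Lemma map_tail_mx (R S : idomainType) (f : {rmorphism R -> S}) n (B : 'M[R]_n.+1) m :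
  map_mx f (tail_mx B m) = tail_mx (map_mx f B) m.
Proof.
rewrite /tail_mx map_horner_mx -map_char_poly; congr horner_mx.
by apply/polyP => i; rewrite coef_map /= !coef_drop_poly coef_map.
Qed.

Lemma ergodic_pointsE n (P : 'M[rat]_n.+1) (iota0 : 'cV[rat]_n.+1) (u : seq unit) :
  exists a m, let B := a *: (P ^+ size u - 1) in
  [/\ a != 0, (char_poly B)`_m != 0, forall i, (i < m)%N -> (char_poly B)`_i = 0 &
    ergodic_points u (rowsof P, colof iota0) =
    [seq colof (P ^+ i *m (((char_poly B)`_m)^-1 *: tail_mx B m *m iota0))
    | i <- iota 0 (size u)]].
Proof.
set x := (rowsof P, colof iota0).
pose D := common_den x; pose A := map_mx (scale D) P; pose v := map_mx (scale D) iota0.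
have D0 : (D%:R : rat) != 0 by rewrite pnatr_eq0 -lt0n common_den_gt0.
have mapA : map_mx intr A = D%:R *: P :> 'M[rat]__.
  apply/matrixP => i j; rewrite !mxE scaleE //; apply: dvdn_common_den.
  rewrite mem_cat; apply/orP; left; apply/flattenP.
  exists [seq P i j | j <- enum 'I_n.+1]; first by apply: map_f; rewrite mem_enum.
  by apply: map_f; rewrite mem_enum.
have mapv : map_mx intr v = D%:R *: iota0 :> 'cV[rat]__.
  apply/matrixP => i j; rewrite !mxE scaleE //; apply: dvdn_common_den.
  rewrite mem_cat (ord1 j); apply/orP; right.
  by apply: (map_f (fun i => iota0 i 0)); rewrite mem_enum.
have mapX i : map_mx intr (A ^+ i) = D%:R ^+ i *: P ^+ i :> 'M[rat]__.
  by rewrite rmorphXn /= mapA exprZn.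
have [m [k [k0 pm pi E]]] := limit_dataE A u D v.
set B0 := A ^+ size u - _ in pm pi E.
have mapB : map_mx intr B0 = D%:R ^+ size u *: (P ^+ size u - 1).
  rewrite /B0 map_mxB /= mapX scalerBr map_scalar_mx /=; congr (_ - _).
  by rewrite -scalemx1 -pmulrn natrX.
(* For A = D P one has A^l - D^l = D^l (P^l - 1), so [a] is D^l. *)
exists (D%:R ^+ size u), m; rewrite -mapB /=.
have pE i : (char_poly (map_mx intr B0 : 'M[rat]_n.+1))`_i = ((char_poly B0)`_i)%:~R.
  by rewrite -map_char_poly coef_map.
split.
- by rewrite expf_neq0.
- by rewrite pE intr_eq0.
- by move=> i /pi; rewrite pE => ->.
rewrite /ergodic_points -/x -/D /x map_rowsof map_colof -/A -/v.
rewrite /int_points E pt_loopE -/(rev _) revK -map_comp.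
apply: eq_map => i /=; rewrite map_colof; congr colof.
have mapdiv (e : rat) (X : 'cV[int]_n.+1) :
    map_mx (fun z => z%:~R / e) X = e^-1 *: map_mx intr X :> 'cV[rat]_n.+1.
  by apply/matrixP => r j; rewrite !mxE mulrC.
rewrite mapdiv map_mxM map_mxZ map_mxM mapX mapv -map_tail_mx pE.
rewrite -?scalemxAl. rewrite -!scalemxAr -?scalemxAl !scalerA. congr (_ *: _).
have k0' : k%:~R != 0 :> rat by rewrite intr_eq0.
have p0 : ((char_poly B0)`_m)%:~R != 0 :> rat by rewrite intr_eq0.
rewrite !intrM rmorphXn /= -pmulrn.
have e0 : (D%:R : rat) ^+ i != 0 by rewrite expf_neq0.
by field; rewrite k0' p0 D0 e0.
Qed.

End RationalPoints.

(** * Powers of stochastic matrices *)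

Section Geometric.
Variable C : archiClosedFieldType.

(** Bernoulli's inequality with the division cleared; it makes r^k small by the Archimedean property
    alone. *)
Lemma exprn_bound (r : C) k : 0 <= r -> r <= 1 -> (1 + k%:R * (1 - r)) * r ^+ k <= 1.
Proof.
move=> r0 r1; elim: k => [|k IH]; first by rewrite mul0r addr0 mulr1.
have -> : (1 + k.+1%:R * (1 - r)) * r ^+ k.+1 =
   (1 + k%:R * (1 - r)) * r ^+ k * r + (1 - r) * r ^+ k.+1.
  by rewrite exprS -natr1; ring.
apply: (@le_trans _ _ (1 * r + (1 - r) * 1)); last by rewrite mul1r mulr1 addrC subrK.
apply: lerD; first by rewrite ler_wpM2r.
by rewrite ler_wpM2l ?subr_ge0 ?exprn_ile1.
Qed.

Definition vanishes (x : nat -> C) :=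
  forall e : C, 0 < e -> exists N, forall k, (N <= k)%N -> `|x k| < e.

Lemma geometric_small (r a e : C) : 0 <= r -> r < 1 -> 0 <= a -> 0 < e ->
  exists j, r ^+ j * a < e.
Proof.
move=> r0 r1 a0 e0.
have s0 : 0 < e * (1 - r) by rewrite mulr_gt0 // subr_gt0.
pose j := Num.bound (a / (e * (1 - r))); exists j.
have hj : a / (e * (1 - r)) < j%:R.
  by apply: archi_boundP; rewrite divr_ge0 // ltW.
have {}hj : a < (1 + j%:R * (1 - r)) * e.
  rewrite ltr_pdivrMr // in hj.
  by rewrite mulrDl mul1r -mulrA [(1 - r) * e]mulrC ltr_wpDl // ltW.
have pos : 0 < 1 + j%:R * (1 - r).
  by rewrite ltr_pwDl // mulr_ge0 ?ler0n // subr_ge0 ltW.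
rewrite -(ltr_pM2l pos) mulrA; apply: le_lt_trans hj.
by rewrite -[leRHS]mul1r ler_wpM2r // exprn_bound // ltW.
Qed.

(** Once |z| is below (1 - r) e / 2, with r = |l|, the map t -> r t + (1 - r) e / 2 bounds the next
    |a| and has fixed point e / 2; what exceeds it decays geometrically. *)
Lemma vanishes_rec (l : C) (a z : nat -> C) :
  `|l| < 1 -> (forall k, a k.+1 = l * a k + z k) -> vanishes z -> vanishes a.
Proof.
move=> l1 ha hz e e0; set r := `|l| in l1.
have r0 : 0 <= r by apply: normr_ge0.
have h2 : (0 < 2 :> C) by [].
have s0 : 0 < e / 2 * (1 - r) by rewrite mulr_gt0 ?divr_gt0 // subr_gt0.
have [N hN] := hz _ s0.
have [j hj] := @geometric_small r `|a N| (e / 2) r0 l1 (normr_ge0 _) (divr_gt0 e0 h2).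
have bnd i : `|a (N + i)%N| <= r ^+ i * `|a N| + e / 2.
  elim: i => [|i IH].
    by rewrite addn0 expr0 mul1r lerDl ltW // divr_gt0.
  rewrite addnS ha; apply: le_trans (ler_normD _ _) _; rewrite normrM -/r.
  have hzi : `|z (N + i)%N| <= e / 2 * (1 - r) by rewrite ltW // hN // leq_addr.
  apply: le_trans (lerD (ler_wpM2l r0 IH) hzi) _.
  by rewrite le_eqVlt; apply/orP; left; apply/eqP; rewrite exprS; ring.
exists (N + j)%N => k hk.
have -> : k = (N + (j + (k - (N + j))))%N by rewrite addnA subnKC.
set i := (k - _)%N; apply: le_lt_trans (bnd _) _.
have {2}-> : e = e / 2 + e / 2 by field.
rewrite ltrD2r; apply: le_lt_trans hj.
rewrite exprD -mulrA ler_wpM2l ?exprn_ge0 //.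
by rewrite -[leRHS]mul1r ler_wpM2r // exprn_ile1 // ltW.
Qed.

Lemma vanishes0 (a : nat -> C) : (forall k, a k = 0) -> vanishes a.
Proof. by move=> h e e0; exists 0%N => k _; rewrite h normr0. Qed.

Variables (n : nat) (P : 'M[C]_n.+1).

Lemma horner_mx_comm (p q : {poly C}) : horner_mx P p *m horner_mx P q = horner_mx P q *m horner_mx P p.
Proof. by rewrite -[LHS]rmorphM mulrC rmorphM. Qed.

(** One root z at a time: by induction P^k (P - z) v tends to 0, so the entries of P^k v satisfy the
    recurrence of [vanishes_rec]. Repeated roots cause no trouble, and no Jordan form is
    involved. *)
Lemma vanishes_kernel (s : seq C) (v : 'cV[C]_n.+1) :
  (forall z, z \in s -> `|z| < 1) ->
  horner_mx P (\prod_(z <- s) ('X - z%:P)) *m v = 0 ->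
  forall i, vanishes (fun k => (P ^+ k *m v) i 0).
Proof.
elim: s v => [|z s IH] v hs; rewrite ?big_nil ?big_cons.
  rewrite rmorph1 mul1mx => -> i.
  by apply: vanishes0 => k; rewrite mulmx0 mxE.
rewrite mulrC rmorphM /= -mulmxA => hv i.
have hz : `|z| < 1 by apply: hs; rewrite mem_head.
have hs' y : y \in s -> `|y| < 1 by move=> ys; apply: hs; rewrite inE ys orbT.
apply: (vanishes_rec hz _ (IH _ hs' hv i)) => k.
rewrite rmorphB /= horner_mx_X horner_mx_C mulmxBl mul_scalar_mx.
rewrite mulmxBr mulmxA -[P ^+ k *m P]exprSr -scalemxAr !mxE; ring.
Qed.

End Geometric.

(** * Eigenvalues of stochastic matrices *)

Section Stochastic.

Lemma stochastic_mul (K : numDomainType) d (P Q : 'M[K]_d) :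
  stochastic P -> stochastic Q -> stochastic (P *m Q).
Proof.
move=> [p0 p1] [q0 q1]; split=> [i j|j].
  by rewrite mxE sumr_ge0 // => k _; rewrite mulr_ge0.
under eq_bigr => i _ do rewrite mxE.
rewrite exchange_big /= -[RHS](q1 j); apply: eq_bigr => k _.
by rewrite -mulr_suml p1 mul1r.
Qed.

Lemma stochastic_exp (K : numDomainType) d (P : 'M[K]_d) k :
  stochastic P -> stochastic (P ^+ k).
Proof.
move=> sP; elim: k => [|k IH]; last by rewrite exprS; apply: stochastic_mul.
rewrite expr0; split=> [i j|j]; first by rewrite mxE ler0n.
rewrite (bigD1 j) //= big1 ?mxE ?eqxx ?addr0 // => i ij.
by rewrite mxE (negbTE ij).
Qed.

Lemma stochastic_le1 (K : numDomainType) d (P : 'M[K]_d) i j : stochastic P -> P i j <= 1.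
Proof.
move=> [p0 p1]; rewrite -(p1 j) (bigD1 i) //= lerDl.
by apply: sumr_ge0.
Qed.

Variables (C : archiClosedFieldType) (n : nat) (P : 'M[C]_n.+1).
Hypothesis sP : stochastic P.

(** [C] is only partially ordered, so maxima are taken over real values. *)
Lemma real_max (I : eqType) (f : I -> C) (s : seq I) : s != [::] ->
  (forall i, f i \is Num.real) -> exists2 i, i \in s & forall j, j \in s -> f j <= f i.
Proof.
move=> s0 hf; elim: s s0 => // x [|y s] IH _.
  by exists x; rewrite ?mem_head // => j; rewrite inE => /eqP ->.
have [//|i si hi] := IH.
have [h|h] := real_leP (hf x) (hf i).
  exists i; first by rewrite inE si orbT.
  by move=> j; rewrite inE => /orP[/eqP -> //|/hi].
exists x; first exact: mem_head.
move=> j; rewrite inE => /orP[/eqP -> //|/hi hj].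
exact: le_trans hj (ltW h).
Qed.

Lemma stochastic_neighbour j : exists i, P i j != 0.
Proof.
case: (pickP (fun i => P i j != 0)) => [i hi|h]; first by exists i.
have := sP.2 j; rewrite big1 => [/eqP|i _]; first by rewrite eq_sym oner_eq0.
by apply/eqP; rewrite -[_ == _]negbK h.
Qed.

(** A left eigenvector is used because columns sum to 1: each entry of y P is a convex combination
    of entries of y. *)
Lemma stochastic_eigenvalue z : eigenvalue P z ->
  `|z| < 1 \/ exists2 k, (0 < k <= n.+1)%N & z ^+ k = 1.
Proof.
move=> /eigenvalueP[y yP y0].
have [p0 p1] := sP.
have yE j : \sum_i P i j * y 0 i = z * y 0 j.
  have /rowP/(_ j) := yP; rewrite !mxE => <-.
  by apply: eq_bigr => i _; rewrite mulrC.
have eN : enum 'I_n.+1 != [::] by rewrite -size_eq0 size_enum_ord.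
have [j0 _ hj0] := real_max eN (fun i => normr_real (y 0 i)).
set m := `|y 0 j0|.
have hm j : `|y 0 j| <= m by apply: hj0; rewrite mem_enum.
have m0 : 0 < m.
  rewrite lt_def normr_ge0 andbT; apply: contraNneq y0 => m0.
  apply/eqP/rowP => j; rewrite mxE; apply/eqP.
  by rewrite -normr_eq0 eq_le normr_ge0 andbT -m0.
have avg j : \sum_i P i j * `|y 0 i| <= m.
  apply: (@le_trans _ _ (\sum_i P i j * m)); last by rewrite -mulr_suml p1 mul1r.
  by apply: ler_sum => i _; rewrite ler_wpM2l.
have le1 : `|z| <= 1.
  rewrite -(ler_pM2r m0) mul1r /m -normrM -yE.
  apply: le_trans (ler_norm_sum _ _ _) (le_trans _ (avg j0)).
  by apply: ler_sum => i _; rewrite normrM ger0_norm.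
have [/eqP|z1] := boolP (`|z| == 1); last by left; rewrite lt_neqAle z1.
move=> z1; right.
(* Under the weights P_ij the values y_i have mean c = z y_j. Their variance is at most m^2 - |c|^2
   = 0, so y_i = c wherever the weight is nonzero. *)
have step j i : `|y 0 j| = m -> P i j != 0 -> y 0 i = z * y 0 j.
  move=> yj pij; set c := z * y 0 j.
  have cm : c * c^* = m ^+ 2 by rewrite -normCK /c normrM z1 mul1r yj.
  have key : \sum_i P i j * `|y 0 i - c| ^+ 2 <= 0.
    have -> : \sum_i P i j * `|y 0 i - c| ^+ 2 = \sum_i P i j * `|y 0 i| ^+ 2 - m ^+ 2.
      have E1 : \sum_i P i j * y 0 i = c by exact: yE.
      have E2 : \sum_i P i j * (y 0 i)^* = c^*.
        rewrite -E1 rmorph_sum; apply: eq_bigr => i' _.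
        by rewrite rmorphM /= (conj_Creal (ger0_real (p0 i' j))).
      transitivity (\sum_i P i j * `|y 0 i| ^+ 2 - (\sum_i P i j * y 0 i) * c^*
         - (\sum_i P i j * (y 0 i)^*) * c + (\sum_i P i j) * (c * c^*)).
        rewrite !mulr_suml -!sumrB -big_split /=; apply: eq_bigr => i' _.
        by rewrite !normCK rmorphB /=; ring.
      by rewrite E1 E2 p1 mul1r [c^* * c]mulrC cm subrK.
    rewrite subr_le0; apply: (@le_trans _ _ (\sum_i P i j * m ^+ 2)).
      by apply: ler_sum => i' _; rewrite ler_wpM2l // lerXn2r ?nnegrE ?normr_ge0 // ltW.
    by rewrite -mulr_suml p1 mul1r.
  have nn i' : true -> 0 <= P i' j * `|y 0 i' - c| ^+ 2.
    by move=> _; rewrite mulr_ge0 // exprn_ge0.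
  have /eqP : \sum_i P i j * `|y 0 i - c| ^+ 2 = 0.
    by apply/eqP; rewrite eq_le key sumr_ge0.
  rewrite psumr_eq0 // => /allP/(_ i (mem_index_enum _)) /=.
  by rewrite mulf_eq0 (negbTE pij) /= sqrf_eq0 normr_eq0 subr_eq0 => /eqP.
have nx j : {i | P i j != 0} by apply/sigW; apply: stochastic_neighbour.
pose x k := iter k (fun j => sval (nx j)) j0.
have yx k : y 0 (x k) = z ^+ k * y 0 j0 /\ `|y 0 (x k)| = m.
  elim: k => [|k [IH1 IH2]]; first by rewrite expr0 mul1r.
  have := step _ _ IH2 (svalP (nx (x k))) => E; rewrite /x /= -/(x k) E IH1.
  by rewrite exprS mulrA; split=> //; rewrite -mulrA normrM z1 mul1r -IH1.
(* Among n + 2 consecutive states of a path two agree, at distance at most n + 1; between them y is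
   multiplied by a power of z, which is therefore 1. *)
have /injectivePn [a [b ab xab]] : ~~ injectiveb (fun k : 'I_n.+2 => x k).
  apply/negP => /injectiveP inj.
  by have := leq_card _ inj; rewrite !card_ord ltnn.
wlog lt : a b ab xab / (a < b)%N.
  move=> H; case: (ltngtP a b) => h; first exact: (H a b).
    by apply: (H b a) => //; rewrite eq_sym.
  by move: ab; rewrite -val_eqE /= h eqxx.
exists (b - a)%N.
  by rewrite subn_gt0 lt /= leq_subLR; have := ltn_ord b; lia.
have zN0 : z != 0 by rewrite -normr_eq0 z1 oner_eq0.
have yj0 : y 0 j0 != 0 by rewrite -normr_eq0 gt_eqF.
have := (yx a).1; rewrite xab (yx b).1 => /(mulIf yj0) E.
apply: (mulfI (expf_neq0 a zN0)).
by rewrite mulr1 -exprD subnKC // ltnW.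
Qed.

End Stochastic.

(** * Semisimplicity of the eigenvalue 1 *)

Section Index.
Variables (K : archiNumFieldType) (n : nat) (P : 'M[K]_n.+1).
Hypothesis sP : stochastic P.

(** If w = (P - 1) v is fixed by P, then P^k v = v + k w, which grows linearly unless w = 0, whereas
    the entries of P^k stay in [0, 1]. The field is merely archimedean, so that this serves the
    rationals and an algebraically closed field alike. *)
Lemma stochastic_index1 (v : 'cV[K]_n.+1) :
  (P - 1) *m ((P - 1) *m v) = 0 -> (P - 1) *m v = 0.
Proof.
set w := (P - 1) *m v => hw.
have Pw : P *m w = w.
  by apply/eqP; rewrite -subr_eq0 -[X in _ - X]mul1mx -mulmxBl hw.
have Pv k : P ^+ k *m v = v + k%:R *: w.
  elim: k => [|k IH]; first by rewrite mul1mx scale0r addr0.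
  rewrite exprS -mulmxA IH mulmxDr -scalemxAr Pw -natr1 scalerDl scale1r.
  have -> : P *m v = v + w by rewrite /w mulmxBl mul1mx addrC subrK.
  by rewrite -addrA [w + _]addrC.
clearbody w; apply/colP => i; rewrite [RHS]mxE; apply/eqP; rewrite -normr_eq0; apply/negPn/negP => wi.
have w0 : 0 < `|w i 0| by rewrite lt_def wi normr_ge0.
pose S := \sum_j `|v j 0|.
have S0 : 0 <= S by apply: sumr_ge0.
have bnd k : k%:R * `|w i 0| <= S + `|v i 0|.
  have -> : k%:R * `|w i 0| = `|(P ^+ k *m v) i 0 - v i 0|.
    by rewrite Pv !mxE addrAC subrr add0r normrM normr_nat.
  apply: le_trans (ler_normB _ _) _; rewrite lerD2r mxE.
  apply: le_trans (ler_norm_sum _ _ _) _; apply: ler_sum => j _.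
  have sk := stochastic_exp k sP.
  rewrite normrM ger0_norm; last by apply: sk.1.
  by rewrite -[leRHS]mul1r ler_wpM2r // stochastic_le1.
have := archi_boundP (divr_ge0 (addr_ge0 S0 (normr_ge0 (v i 0))) (ltW w0)).
rewrite ltr_pdivrMr // => h; by have := lt_le_trans h (bnd _); rewrite ltxx.
Qed.

Lemma stochastic_index (v : 'cV[K]_n.+1) k :
  (P - 1) ^+ k.+1 *m v = 0 -> (P - 1) *m v = 0.
Proof.
elim: k v => [|k IH] v; first by rewrite expr1.
by rewrite exprSr -mulmxA => /IH /stochastic_index1.
Qed.

End Index.

(** * Convergence to the projection *)

Section Limit.

Lemma prod_XsubC_dvd_exp (K : fieldType) (q : {poly K}) (s : seq K) :
  (forall z, z \in s -> root q z) -> \prod_(z <- s) ('X - z%:P) %| q ^+ size s.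
Proof.
elim: s => [|z s IH] h; first by rewrite big_nil dvd1p.
rewrite big_cons exprS; apply: dvdp_mul.
  by rewrite dvdp_XsubCl h // mem_head.
by apply: IH => y ys; apply: h; rewrite inE ys orbT.
Qed.

(** The characteristic polynomial is f g, with the roots of f inside the unit disc and those of g
    roots of q = X^((n+1)!) - 1, so g divides a power of q. By Cayley-Hamilton a power of Q - 1
    annihilates f(P) v; by semisimplicity so does Q - 1 itself. Hence f(P) annihilates (Q - 1) v. *)
Lemma stochastic_period_vanishes (C : archiClosedFieldType) n (P : 'M[C]_n.+1) (v : 'cV[C]_n.+1) :
  stochastic P ->
  forall i, vanishes (fun k => (P ^+ k *m ((P ^+ (n.+1)`! - 1) *m v)) i 0).
Proof.
move=> sP; set Q := P ^+ _.
have [s Ds] := closed_field_poly_normal (char_poly P).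
rewrite (monicP (char_poly_monic P)) scale1r in Ds.
have hs z : z \in s -> `|z| < 1 \/ z ^+ (n.+1)`! = 1.
  move=> zs; have : eigenvalue P z by rewrite eigenvalue_root_char Ds root_prod_XsubC.
  move=> /(stochastic_eigenvalue sP) [|[k hk zk]]; first by left.
  by right; have /dvdnP[q ->] := dvdn_fact hk; rewrite mulnC exprM zk expr1n.
pose s1 := [seq z <- s | `|z| < 1]; pose s2 := [seq z <- s | ~~ (`|z| < 1)].
pose f := \prod_(z <- s1) ('X - z%:P); pose g := \prod_(z <- s2) ('X - z%:P).
have Dfg : char_poly P = g * f.
  rewrite Ds mulrC /f /g /s1 /s2 !big_filter.
  by rewrite (bigID (fun z => `|z| < 1)).
pose q : {poly C} := 'X^((n.+1)`!) - 1.
(* One extra power matches the exponent [k.+1] of [stochastic_index]. *)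
have hg : g %| q ^+ (size s2).+1.
  apply: (dvdp_trans (prod_XsubC_dvd_exp (q := q) _)).
    move=> z; rewrite mem_filter => /andP[z1 /hs[h|zl]]; first by rewrite h in z1.
    by rewrite /root !hornerE ?hornerXn zl subrr.
  by rewrite exprS dvdp_mull.
have hq : horner_mx P q = Q - 1.
  by rewrite /q rmorphB rmorph1 rmorphXn /= horner_mx_X.
move=> i; apply: (@vanishes_kernel _ _ _ s1).
  by move=> z; rewrite mem_filter => /andP[].
rewrite -/f; have comm : horner_mx P f *m (Q - 1) = (Q - 1) *m horner_mx P f.
  by rewrite -hq horner_mx_comm.
rewrite mulmxA comm -mulmxA.
apply: (@stochastic_index _ _ Q (stochastic_exp _ sP) _ (size s2)).
rewrite -hq -rmorphXn /= mulmxA.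
have [h ->] : exists h, q ^+ (size s2).+1 = h * g by apply/dvdpP.
rewrite -[_ *m horner_mx P f]rmorphM /= -mulrA -Dfg rmorphM /= Cayley_Hamilton.
by rewrite mulr0 mul0mx.
Qed.

Section Projection.
Variables (n : nat) (P : 'M[rat]_n.+1) (a : rat) (m : nat).
Hypothesis sP : stochastic P.
Let Q := P ^+ (n.+1)`!.
Let B := a *: (Q - 1).
Let E := ((char_poly B)`_m)^-1 *: tail_mx B m.
Hypothesis a0 : a != 0.
Hypothesis pm : (char_poly B)`_m != 0.
Hypothesis pi : forall i, (i < m)%N -> (char_poly B)`_i = 0.

(** It starts from Cayley-Hamilton, p(B) = 0; as the coefficients below m vanish, each Horner step
    splits off a factor B. For i = m this reads B^m h(B) = 0. *)
Lemma tail_mx_exp i : (i <= m)%N -> B ^+ i *m tail_mx B i = 0.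
Proof.
elim: i => [|i IH] hi; first by rewrite tail_mx0 mulmx0.
by have := IH (ltnW hi); rewrite tail_mxE pi // raddf0 add0r mulmxA -[B ^+ i *m B]exprSr.
Qed.

Lemma limit_mx_fixed (v : 'cV[rat]_n.+1) : Q *m (E *m v) = E *m v.
Proof.
apply/eqP; rewrite -subr_eq0 -[X in _ - X]mul1mx -mulmxBl; apply/eqP.
have : (Q - 1) ^+ m *m (tail_mx B m *m v) = 0.
  have := tail_mx_exp (leqnn m); rewrite /B exprZn -scalemxAl => /eqP.
  rewrite scalemx_eq0 expf_eq0 (negbTE a0) andbF /= => /eqP h.
  by rewrite mulmxA h mul0mx.
rewrite -scalemxAl -scalemxAr; case: (m) => [|m'].
  (* For m = 0 the tail is p(B) = 0 itself; otherwise the power of Q - 1 is reduced to the first. *)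
  by rewrite tail_mx0 mul0mx !mulmx0 scaler0.
by move=> /(stochastic_index (stochastic_exp _ sP)) ->; rewrite scaler0.
Qed.

(** Since E - 1 is a multiple of B, E v - v lies in the image of Q - 1, on which P^k tends to 0. The
    decay is obtained over the algebraic numbers and read back through the order embedding
    [ratr]. *)
Lemma limit_mx_cvg (v : 'cV[rat]_n.+1) (e : rat) : 0 < e ->
  exists N, forall k i, (N <= k)%N -> `|(P ^+ k *m (E *m v) - P ^+ k *m v) i 0| < e.
Proof.
move=> e0; pose c : rat -> algC := ratr.
pose w := (a / (char_poly B)`_m) *: (tail_mx B m.+1 *m v).
have Ew : E *m v - v = (Q - 1) *m w.
  have -> : E = 1%:M + ((char_poly B)`_m)^-1 *: (B *m tail_mx B m.+1).
    by rewrite /E {1}tail_mxE scalerDr scale_scalar_mx mulVf.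
  rewrite mulmxDl mul1mx addrC addKr /w -scalemxAr -scalemxAl -mulmxA.
  move: (tail_mx B m.+1 *m v) ((char_poly B)`_m) => y x.
  by rewrite /B -scalemxAl scalerA mulrC.
have sPc : stochastic (map_mx c P).
  split=> [i j|j]; first by rewrite mxE ler0q; apply: sP.1.
  under eq_bigr => i _ do rewrite mxE.
  by rewrite -rmorph_sum sP.2 rmorph1.
have van i := @stochastic_period_vanishes _ _ _ (map_mx c w) sPc i.
have hc : 0 < c e by rewrite ltr0q.
have [N hN] : exists N, forall i k, (N <= k)%N ->
   `|(map_mx c P ^+ k *m ((map_mx c P ^+ (n.+1)`! - 1) *m map_mx c w)) i 0| < c e.
  (* One N for all coordinates, by induction on a list of indices. *)
  have : forall s : seq 'I_n.+1, exists N, forall i k, i \in s -> (N <= k)%N ->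
   `|(map_mx c P ^+ k *m ((map_mx c P ^+ (n.+1)`! - 1) *m map_mx c w)) i 0| < c e.
    elim=> [|i s [N hN]]; first by exists 0%N.
    have [N' hN'] := van i _ hc.
    exists (maxn N N') => j k; rewrite inE geq_max => /orP[/eqP ->|js] /andP[h1 h2].
      exact: hN'.
    exact: hN.
  move=> /(_ (enum 'I_n.+1))[N hN]; exists N => i k hk.
  by apply: hN; rewrite ?mem_enum.
exists N => k i /(hN i).
have -> : map_mx c P ^+ k *m ((map_mx c P ^+ (n.+1)`! - 1) *m map_mx c w) =
    map_mx c (P ^+ k *m (E *m v) - P ^+ k *m v).
  rewrite -mulmxBr Ew !map_mxM !map_mxB /= /Q !rmorphXn /=.
  by rewrite map_mx1.
by rewrite mxE -[c _]/(ratr _) -ratr_norm ltr_rat.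
Qed.

End Projection.
End Limit.

(** * Mean payoff *)

Section Cesaro.
Variable R : realType.

Lemma periodic_mod (T : Type) (c : nat -> T) l k :
  (forall k, c (k + l)%N = c k) -> c (k %% l)%N = c k.
Proof.
move=> hc; rewrite {2}(divn_eq k l) addnC.
by elim: (k %/ l)%N => [|q IH]; rewrite ?addn0 // mulSnr addnA hc.
Qed.

(** The means of u - c tend to 0 by Cesaro's theorem. With s the mean of c over a period, the
    partial sums of c - s are again l-periodic, hence bounded, and vanish after division by n. *)
Lemma cesaro_periodic (u c : R^nat) l : (0 < l)%N ->
  (forall k, c (k + l)%N = c k) -> (fun k => u k - c k) @ \oo --> (0 : R) ->
  (fun n => n%:R^-1 * \sum_(0 <= k < n) u k) @ \oo --> l%:R^-1 * \sum_(i < l) c i.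
Proof.
move=> l0 hc huc; set s := l%:R^-1 * _.
pose b n := \sum_(0 <= k < n) (c k - s).
have lR : (l%:R : R) != 0 by rewrite pnatr_eq0 -lt0n.
have bl : b l = 0.
  rewrite /b big_mkord sumrB sumr_const card_ord /s -[_ *+ l]mulr_natl mulrA divff //.
  by rewrite mul1r subrr.
have hb k : b (k + l)%N = b k.
  elim: k => [|k IH]; first by rewrite add0n bl /b big_geq.
  by rewrite /b addSn !big_nat_recr //= hc -/(b (k + l)%N) IH.
pose M := \sum_(i < l) `|b i|.
have hM k : `|b k| <= M.
  rewrite -(periodic_mod k hb) /M (bigD1 (Ordinal (ltn_pmod k l0))) //=.
  by rewrite lerDl sumr_ge0.
rewrite -cvg_shiftS /=.
have h0 : (fun n => n.+1%:R^-1 * b n.+1) @ \oo --> (0 : R).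
  apply/norm_cvg0P; apply: (@squeeze_cvgr _ _ _ _ (fun=> 0) (fun n => M * n.+1%:R^-1)).
  - near=> n; rewrite normr_ge0 /= normrM mulrC (ger0_norm (_ : 0 <= n.+1%:R^-1)) ?invr_ge0 //.
    by rewrite ler_wpM2r // invr_ge0.
  - exact: cvg_cst.
  - rewrite -[X in _ --> X](mulr0 M); exact: cvgM (cvg_cst M) cvg_harmonic.
have h1 := cesaro huc.
have : arithmetic_mean (fun k => u k - c k) n + n.+1%:R^-1 * b n.+1 + s @[n --> \oo] --> 0 + 0 + s.
  by apply: cvgD; [apply: cvgD|exact: cvg_cst].
rewrite !add0r; apply: cvg_trans.
apply: near_eq_cvg; near=> n => /=.
have n0 : (n.+1%:R : R) != 0 by rewrite pnatr_eq0.
have -> : s = n.+1%:R^-1 * (\sum_(0 <= k < n.+1) s).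
  by rewrite sumr_const_nat subn0 -[s *+ _]mulr_natl mulKf.
rewrite /arithmetic_mean /b !seriesEnat /= -!mulrDr -!big_split /=; congr (_ * _).
by apply: eq_bigr => k _; ring.
Unshelve. all: by end_near.
Qed.

(** [w] need not be uniformly continuous; but p takes only l values, so one radius serves for all of
    them. *)
Lemma continuous_periodic d (w : 'cV[R]_d -> R) (x p : nat -> 'cV[R]_d) l :
  (0 < l)%N -> (forall k, p (k + l)%N = p k) -> continuous w ->
  (forall e : R, 0 < e -> exists N, forall k i, (N <= k)%N -> `|(p k - x k) i 0| < e) ->
  (fun k => w (x k) - w (p k)) @ \oo --> (0 : R).
Proof.
move=> l0 hp cw hx; apply/cvgrPdist_lt => e e0.
have [dl dl0 hdl] : exists2 dl : R, 0 < dl & forall r z, (r < l)%N ->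
    (forall i, `|(p r - z) i 0| < dl) -> `|w z - w (p r)| < e.
  elim: l {l0 hp} => [|l [dl dl0 IH]]; first by exists 1.
  have /cvgrPdist_lt/(_ e e0) := cw (p l).
  rewrite nearE nbhs_ballP => -[dl' dl'0 h'].
  exists (Num.min dl dl'); first by rewrite lt_min dl0.
  move=> r z; rewrite ltnS leq_eqVlt => /orP[/eqP ->|hr] hz.
    rewrite distrC; apply: h'; split=> // i j; rewrite (ord1 j).
    have := hz i; rewrite lt_min => /andP[_]; rewrite !mxE; exact.
  apply: IH => // i; apply: lt_le_trans (hz i) _; by rewrite ge_min lexx.
have [N hN] := hx dl dl0.
exists N => // k /= hk; rewrite sub0r normrN -(periodic_mod k hp).
apply: hdl; first exact: ltn_pmod.
by move=> i; rewrite (periodic_mod k hp); apply: hN.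
Qed.

End Cesaro.

(** * Tree sizes and running time in terms of bit lengths *)

Section Encoding.

Lemma enc_map (T : Type) (A : encType) (f : T -> A) s :
  enc [seq f x | x <- s] = enc_seq (fun x => enc (f x)) s.
Proof. by rewrite /enc /=; elim: s => //= x s ->. Qed.

Lemma eq_enc_seq (T : Type) (f g : T -> tree) s : f =1 g -> enc_seq f s = enc_seq g s.
Proof. by move=> fg; elim: s => //= x s ->; rewrite fg. Qed.

Lemma enc_colof d (v : 'cV[rat]_d) : enc (colof v) = enc_vec v.
Proof. exact: enc_map. Qed.

Lemma enc_rowsof d (A : 'M[rat]_d) : enc (rowsof A) = enc_mx A.
Proof. by rewrite /rowsof enc_map; apply: eq_enc_seq => i; apply: enc_map. Qed.

Lemma enc_points_iota d l (f : nat -> 'cV[rat]_d) :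
  enc [seq colof (f i) | i <- iota 0 l] = enc_points (fun i : 'I_l => f i).
Proof.
rewrite -val_enum_ord -map_comp enc_map; apply: eq_enc_seq => i /=.
exact: enc_colof.
Qed.

Local Open Scope nat_scope.

(** There are at most 4 nodes per bit; sign, list ends and pairing take at most 7 more, charged to
    the sign bit of [rat_bitlen]. *)
Lemma esize_rat (q : rat) : esize q <= 7 * rat_bitlen q.
Proof.
rewrite -[esize q]/(esize ((numq q < 0)%R, `|numq q|, `|denq q|)) !esize_pair.
rewrite /rat_bitlen; have := esize_nat_le (ltn_bits `|numq q|).
have := esize_nat_le (ltn_bits `|denq q|); have := esize_bool_le (numq q < 0)%R.
lia.
Qed.

Lemma esize_map_le (T : Type) (A : encType) (f : T -> A) (g : T -> nat) s :
  (forall x, (esize (f x)).+1 <= g x) ->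
  esize [seq f x | x <- s] <= 1 + \sum_(x <- s) g x.
Proof.
move=> h; elim: s => [|x s IH]; first by rewrite big_nil.
by rewrite big_cons /= esize_cons; have := h x; lia.
Qed.

(** Here 13 = 8 + 2 + 3: 8 per bit for entries with their list cells, 2 per row and 3 for the ends.
    The last two are absorbed by the bit length of the vector, which is at least d >= 1. *)
Lemma esize_input d (P : 'M[rat]_d) (v : 'cV[rat]_d) : 0 < d ->
  esize (rowsof P, colof v) <= 13 * input_bitlen P v.
Proof.
move=> d0; rewrite esize_pair /input_bitlen.
have bl q : (esize q).+1 <= 8 * rat_bitlen q.
  by have := esize_rat q; rewrite /rat_bitlen; lia.
have h1 : esize (colof v) <= 1 + \sum_(i < d) 8 * rat_bitlen (v i ord0).
  rewrite -big_enum; exact: esize_map_le.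
have h2 : esize (rowsof P) <= 1 + \sum_(i < d) (2 + \sum_(j < d) 8 * rat_bitlen (P i j)).
  rewrite -big_enum; apply: esize_map_le => i.
  rewrite -big_enum /= add2n !ltnS; exact: esize_map_le.
have h3 : d <= \sum_(i < d) rat_bitlen (v i ord0).
  rewrite -{1}(card_ord d) -sum1_card; apply: leq_sum => i _.
  by rewrite /rat_bitlen; lia.
have E8 (F : 'I_d -> nat) : \sum_i 8 * F i = 8 * \sum_i F i by rewrite big_distrr.
move: h1 h2; rewrite big_split /= sum_nat_const card_ord E8.
have -> : \sum_(i < d) \sum_(j < d) 8 * rat_bitlen (P i j)
    = 8 * \sum_(i < d) \sum_(j < d) rat_bitlen (P i j).
  by rewrite -E8; apply: eq_bigr => i _; rewrite E8.
have arith r c a b : c <= 1 + 8 * b -> r <= 1 + (d * 2 + 8 * a) -> d <= b ->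
  (r + c).+1 <= 13 * (a + b) by lia.
by move=> h1 h2; apply: arith h1 h2 h3.
Qed.

Lemma fact_le_exp n m : n <= m -> n`! <= m ^ n.
Proof.
elim: n => // n IH h; rewrite factS expnS leq_mul //.
exact: IH (ltnW h).
Qed.

(** The factorial dominates, with d! <= d^d <= n^n <= 2^(n^2); the summand n + 8 in the exponent
    absorbs the linear terms. *)
Lemma time_bound k d n e : 0 < d -> d <= n -> e <= 13 * n ->
  (2 * d`! + 2 * e + 5) ^ k <= 2 ^ (k * (n ^ 2 + n + 8)).
Proof.
move=> d0 dn en; rewrite [k * _]mulnC expnM.
suff h : 2 * d`! + 2 * e + 5 <= 2 ^ (n ^ 2 + n + 8) by case: k => // k; rewrite leq_exp2r.
have h1 : d`! <= 2 ^ (n ^ 2).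
  apply: leq_trans (fact_le_exp (leqnn d)) _.
  rewrite expnS expn1 expnM; apply: (@leq_trans (n ^ n)).
    apply: (@leq_trans (n ^ d)); first by rewrite leq_exp2r.
    by rewrite leq_pexp2l // (leq_trans d0 dn).
  by case: (n) => // m; rewrite leq_exp2r // ltnW // ltn_expl.
have h2 := ltn_expl n (ltnSn 1).
have h3 : 0 < 2 ^ (n ^ 2) by rewrite expn_gt0.
rewrite -addnA !expnD; move: (2 ^ (n ^ 2)) (2 ^ n) h1 h2 h3 => x y h1 h2 h3.
rewrite -[2 ^ 8]/256; nia.
Qed.

End Encoding.

Lemma ratr_points_cvg (R : realType) n (P : 'M[rat]_n.+1) (v Ev : 'cV[rat]_n.+1) (w : 'cV[R]_n.+1 -> R) :
  let l := (n.+1)`! in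
  P ^+ l *m Ev = Ev ->
  (forall e : rat, 0 < e -> exists N, forall k i, (N <= k)%N ->
     `|(P ^+ k *m Ev - P ^+ k *m v) i 0| < e) ->
  continuous w ->
  payoff_average w (map_mx ratr P) (map_mx ratr v) @ \oo -->
    l%:R^-1 * \sum_(i < l) w (map_mx ratr (P ^+ i *m Ev)).
Proof.
move=> l hfix hcvg cw.
pose p k : 'cV[R]_n.+1 := map_mx ratr (P ^+ k *m Ev).
pose x k : 'cV[R]_n.+1 := map_mx ratr P ^+ k *m map_mx ratr v.
have xE k : x k = map_mx ratr (P ^+ k *m v) by rewrite /x map_mxM /= rmorphXn.
have pp k : p (k + l)%N = p k.
  by rewrite /p exprD -mulmxA hfix.
apply: (@cesaro_periodic R (w \o x) (w \o p) l (fact_gt0 _)).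
  by move=> k /=; rewrite pp.
apply: (@continuous_periodic R _ w x p l (fact_gt0 _) pp cw) => e e0.
(* Convergence is known for rational tolerances only, so a positive rational below [e] is chosen. *)
have [q q0 qe] : exists2 q : rat, 0 < q & ratr q <= e.
  pose m := Num.bound e^-1; exists (m.+1%:R)^-1; first by rewrite invr_gt0 ltr0n.
  rewrite fmorphV rmorph_nat /= -[leRHS]invrK lef_pV2 ?posrE ?ltr0n ?invr_gt0 //.
  apply: ltW; apply: lt_le_trans (archi_boundP _) _; first by rewrite invr_ge0 ltW.
  by rewrite ler_nat.
have [N hN] := hcvg q q0.
exists N => k i hk; apply: lt_le_trans qe.
by rewrite /p xE -map_mxB mxE -ratr_norm ltr_rat hN.
Qed.

Theorem theorem21 (R : realType) :
  exists (M : program) (q : {poly nat}),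
  forall (d : nat) (P : 'M[rat]_d) (iota : 'cV[rat]_d),
    stochastic P -> initial_distribution iota ->
  exists (l : nat) (pts : 'I_l -> 'cV[rat]_d),
    [/\ (0 < l <= d ^ d)%N,
        outputs_within M (enc_input P iota) (enc_points pts)
          (2 ^ q.[input_bitlen P iota]%R)%N
      & forall w : 'cV[R]_d -> R, continuous w ->
          cvgn (payoff_average w (map_mx ratr P) (map_mx ratr iota)) /\
          mean_payoff w (map_mx ratr P) (map_mx ratr iota)
            = l%:R^-1 * \sum_(i < l) w (map_mx ratr (pts i))].
Proof.
have [M [k hM]] := ergodic_points_time.
exists M, (k%:P * ('X^2 + 'X + 8%:P)) => -[|n] P v sP sv.
  (* In dimension 0 there is no initial distribution: the empty sum is 0. *)
  by have := sv.2; rewrite big_ord0 => /eqP; rewrite eq_sym oner_eq0.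
set x := (rowsof P, colof v).
have szu : size (unary_fact x.2) = (n.+1)`!.
  by rewrite size_unary_fact size_map size_enum_ord.
have [a [m [a0 pm pi E]]] := ergodic_pointsE P v (unary_fact x.2).
rewrite szu in a0 pm pi E.
have hfix := limit_mx_fixed sP a0 pi v.
have hcvg := limit_mx_cvg sP pm v.
move: hfix hcvg E; set Ev := _ *m v => hfix hcvg E.
exists (n.+1)`!, (fun i => P ^+ i *m Ev); split.
- by rewrite fact_gt0 fact_le_exp.
- rewrite -(enc_points_iota _ (fun i => P ^+ i *m Ev)) -E.
  have -> : enc_input P v = enc x by rewrite /x enc_pair enc_rowsof enc_colof.
  apply: within_le (hM x) _.
  have -> : size x.2 = n.+1 by rewrite size_map size_enum_ord.
  set b := input_bitlen P v.
  have -> : (k%:P * ('X^2 + 'X + 8%:P)).[b] = (k * (b ^ 2 + b + 8))%N.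
    by rewrite hornerCM !hornerD hornerXn hornerX hornerC; congr (_ * (_ + _ + _))%N; rewrite -mulnn.
  apply: time_bound => //.
    apply: (@leq_trans (\sum_(i < n.+1) rat_bitlen (v i ord0))); last exact: leq_addl.
    rewrite -{1}(card_ord n.+1) -sum1_card; apply: leq_sum => i _.
    by rewrite /rat_bitlen -addnA.
  exact: esize_input.
move=> w cw; have h := ratr_points_cvg hfix hcvg cw.
by split; [apply/cvg_ex; eexists; exact: h|apply: cvg_lim].
Qed.
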